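(* Let $X_n\sim ID(b_n,0,\nu_n)$, $n\ge1$, be a sequence of nondegenerate random variables converging in law towards a nondegenerate $X_\infty\sim ID(b_\infty,0,\nu_\infty)$, with $\mathbb{E}|X_n|<+\infty$ for all $n\ge1$, $\mathbb{E}|X_\infty|<+\infty$, and $$\nu_n(du)=\frac{\psi_{1,n}(u)}{u}\mathbf{1}_{(0,+\infty)}(u)\,du+\frac{\psi_{2,n}(-u)}{(-u)}\mathbf{1}_{(-\infty,0)}(u)\,du,$$ $$\nu_\infty(du)=\frac{\psi_{1,\infty}(u)}{u}\mathbf{1}_{(0,+\infty)}(u)\,du+\frac{\psi_{2,\infty}(-u)}{(-u)}\mathbf{1}_{(-\infty,0)}(u)\,du,$$ where $\psi_{1,n},\psi_{2,n},\psi_{1,\infty},\psi_{2,\infty}$ are decreasing functions on $(0,+\infty)$. Let $\varphi_\infty$ be the characteristic function of $X_\infty$ and suppose there are $C_\infty>0$, $p_\infty\ge1$ such that for all $t\in\mathbb{R}$ $$|\varphi_\infty(t)|\int_0^{|t|}\frac{ds}{|\varphi_\infty(s)|}\le C_\infty|t|^{p_\infty}.$$ Let the law of $X_\infty$ be absolutely continuous with respect to the Lebesgue measure with a bounded density. Then there is a constant $C'_\infty>0$, depending only on the law of $X_\infty$ and on $C_\infty,p_\infty$, such that for all $n\ge1$ $$d_K(X_n,X_\infty)\le C'_\infty\,(\Delta_n)^{\frac{1}{p_\infty+2}},$$ where $$\Delta_n=|\mathbb{E}X_n-\mathbb{E}X_\infty|+\int_0^1|u||\psi_{1,n}(u)-\psi_{1,\infty}(u)|du+\int_1^{+\infty}|\psi_{1,n}(u)-\psi_{1,\infty}(u)|du$$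 $$\qquad+\int_{-1}^0|u||\psi_{2,n}(-u)-\psi_{2,\infty}(-u)|du+\int_{-\infty}^{-1}|\psi_{2,n}(-u)-\psi_{2,\infty}(-u)|du.$$
   Context: A Lévy measure is a positive Borel measure $\nu$ on $\mathbb{R}$ with $\nu(\{0\})=0$ and $\int(1\wedge u^2)\nu(du)<\infty$. $X\sim ID(b,0,\nu)$ means that $\nu$ is a Lévy measure and $\mathbb{E}e^{itX}=\exp\big(itb+\int(e^{itu}-1-itu\mathbf{1}_{|u|\le1})\nu(du)\big)$ for all $t\in\mathbb{R}$. ''Decreasing'' is in the non-strict sense. $d_K(X,Y)=\sup_{x\in\mathbb{R}}|\mathbb{P}(X\le x)-\mathbb{P}(Y\le x)|$. *)

(* Defs.v *)
From HB Require Import structures.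
From mathcomp Require Import all_boot all_order all_algebra.
From mathcomp Require Import complex.
From mathcomp Require Import all_classical all_reals all_analysis.

Set Implicit Arguments.
Unset Strict Implicit.
Unset Printing Implicit Defensive.

Import Order.TTheory GRing.Theory Num.Theory.
Import numFieldNormedType.Exports.

Local Open Scope classical_set_scope.
Local Open Scope ring_scope.
Local Open Scope complex_scope.

(* The real-valued modulus on R[i]; the generic norm `|z| lives in R[i]. *)
Notation normc := ComplexField.Normc.normc.

Definition cexp (R : realType) (z : R[i]) : R[i] :=
  (expR (complex.Re z))%:C * (cos (complex.Im z) +i* sin (complex.Im z)).

(* e^{i x} for real x *)
Definition expi (R : realType) (x : R) : R[i] := cexp ('i * x%:C).

(* Componentwise integral. [Rintegral] returns 0 on a non-integrable component;
   all the integrands used below are integrable for the measures at hand. *)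
Definition Cintegral d (T : measurableType d) (R : realType)
    (m : {measure set T -> \bar R}) (f : T -> R[i]) : R[i] :=
  (\int[m]_x complex.Re (f x)) +i* (\int[m]_x complex.Im (f x)).

Definition charfun d (T : measurableType d) (R : realType)
    (P : probability T R) (X : {RV P >-> R}) (t : R) : R[i] :=
  Cintegral P (fun w => expi (t * X w)).

Definition levy_measure (R : realType) (nu : {measure set R -> \bar R}) : Prop :=
  nu [set 0] = 0%E /\ (\int[nu]_u (Num.min 1 (u ^+ 2))%:E < +oo)%E.

Definition levy_exponent (R : realType) (b : R)
    (nu : {measure set R -> \bar R}) (t : R) : R[i] :=
  'i * (t * b)%:C +
  Cintegral nu
    (fun u => expi (t * u) - 1 - 'i * (t * u)%:C * (`|u| <= 1)%R%:R).

(* X ~ ID(b, 0, nu) *)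
Definition ID d (T : measurableType d) (R : realType) (P : probability T R)
    (X : {RV P >-> R}) (b : R) (nu : {measure set R -> \bar R}) : Prop :=
  levy_measure nu /\ forall t : R, charfun X t = cexp (levy_exponent b nu t).

Definition nondegenerate_rv d (T : measurableType d) (R : realType)
    (P : probability T R) (X : {RV P >-> R}) : Prop :=
  ~ exists c : R, {ae P, forall w, X w = c}.

(* The X_n may live on different probability spaces. *)
Definition cvg_in_law (R : realType)
    (d : nat -> measure_display) (T : forall n, measurableType (d n))
    (P : forall n, probability (T n) R) (X : forall n, {RV (P n) >-> R})
    d' (T' : measurableType d') (P' : probability T' R) (Y : {RV P' >-> R}) :
    Prop :=
  forall f : R -> R, continuous f -> bounded_fun f ->
    ('E_(P n)[fun w => f (X n w)] @[n --> \oo] --> 'E_P'[fun w => f (Y w)])%E.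

Definition finite_mean d (T : measurableType d) (R : realType)
    (P : probability T R) (X : {RV P >-> R}) : Prop :=
  ('E_P[fun w => `|X w|%R] < +oo)%E.

Definition decreasing_on_pos (R : realType) (psi : R -> R) : Prop :=
  forall u v : R, 0 < u -> u <= v -> psi v <= psi u.

(* psi1 and psi2 are only meant on ]0, +oo[; their values outside ]0, +oo[ are
   multiplied by 0. *)
Definition levy_density (R : realType) (psi1 psi2 : R -> R) (u : R) : R :=
  psi1 u / u * \1_(`]0, +oo[ : set R) u +
  psi2 (- u) / (- u) * \1_(`]-oo, 0[ : set R) u.

Definition has_density (R : realType) (m : {measure set R -> \bar R})
    (f : R -> R) : Prop :=
  forall A : set R, measurable A ->
    m A = (\int[lebesgue_measure]_(u in A) (f u)%:E)%E.

Definition has_bounded_density (R : realType) (m : {measure set R -> \bar R}) :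
    Prop :=
  exists f : R -> R,
    [/\ measurable_fun setT f, forall x, 0 <= f x,
        exists M : R, forall x, f x <= M & has_density m f].

Definition dK (R : realType) d (T : measurableType d) (P : probability T R)
    d' (T' : measurableType d') (P' : probability T' R)
    (X : {RV P >-> R}) (Y : {RV P' >-> R}) : \bar R :=
  ereal_sup (range (fun x : R => `|cdf X x - cdf Y x|%E)).

Definition Delta (R : realType) d (T : measurableType d) (P : probability T R)
    d' (T' : measurableType d') (P' : probability T' R)
    (X : {RV P >-> R}) (Y : {RV P' >-> R})
    (psi1 psi2 psi1' psi2' : R -> R) : \bar R :=
  (`| 'E_P[X] - 'E_P'[Y] |
   + \int[lebesgue_measure]_(u in `]0%R, 1%R[)
       (`|u| * `|psi1 u - psi1' u|)%R%:E
   + \int[lebesgue_measure]_(u in `]1%R, +oo[)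
       (`|psi1 u - psi1' u|)%R%:E
   + \int[lebesgue_measure]_(u in `](-1)%R, 0%R[)
       (`|u| * `|psi2 (- u) - psi2' (- u)|)%R%:E
   + \int[lebesgue_measure]_(u in `]-oo, (-1)%R[)
       (`|psi2 (- u) - psi2' (- u)|)%R%:E)%E.

(* Main.v *)
(* Let D be the bound Delta. Subtracting the two Levy-Khintchine exponents gives
     eta_n(t) - eta(t) = i t beta + \int (e^{itu} - 1 - i t u) (nu_n - nu)(du)
   where beta is the difference of the drifts corrected by the jumps larger than
   1; dividing by t and letting t -> 0 identifies beta with E X_n - E X, without
   any integrability of nu_n and nu separately. As both exponents have a
   nonpositive real part, exp is 1-Lipschitz on them, and the characteristic
   functions differ by O((t + t^2) D).
   For the smoothing step, atan y = \int_0^oo e^{-t} sin(t y) / t dt turns this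
   into a bound O(D / delta^2) on the difference of the expectations of
   atan ((X - x) / delta). The truncation of atan at +-atan 2 compares the
   distribution functions up to a shift of 4 delta, which costs 4 delta M for a
   density bounded by M; the rest of atan is nondecreasing of total variation
   pi - 2 atan 2 < 2 atan 2, so that its contribution is absorbed. Hence
   d_K = O(D / delta^2 + M delta) for all delta in ]0, 1], and one takes
   delta = D^{1/(p+2)}. *)
Require Import Defs.
From HB Require Import structures.
From mathcomp Require Import all_boot all_order all_algebra.
From mathcomp Require Import complex.
From mathcomp Require Import all_classical all_reals all_analysis.
From mathcomp Require Import measurable_realfun ring lra.

Set Implicit Arguments.
Unset Strict Implicit.
Unset Printing Implicit Defensive.

Import Order.TTheory GRing.Theory Num.Theory.
Import numFieldNormedType.Exports.

Local Open Scope classical_set_scope.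
Local Open Scope ring_scope.

(** * Elementary inequalities *)

Section elementary_bounds.
Context {R : realType}.
Implicit Types a b x y t : R.

Lemma lipschitz_of_derive_bound (f df : R -> R) (k : R) :
  (forall x, is_derive x 1 f (df x)) -> (forall x, `|df x| <= k) ->
  forall a b, `|f a - f b| <= k * `|a - b|.
Proof.
move=> fdf dfk a b; wlog ab : a b / a <= b => [H|].
  have [/H //|/ltW/H] := leP a b.
  by rewrite distrC (distrC b).
have [c _] := @MVT_segment R f df a b ab (fun x _ => fdf x)
  (derivable_within_continuous (fun x _ => @ex_derive _ _ _ _ _ _ _ (fdf x))).
by rewrite distrC => ->; rewrite normrM (distrC a) ler_wpM2r.
Qed.

Lemma dist_sin_le a b : `|sin a - sin b| <= `|a - b|.
Proof.
rewrite -[leRHS]mul1r.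
by apply: (@lipschitz_of_derive_bound sin cos) => x; exact: cos_max.
Qed.

Lemma dist_cos_le a b : `|cos a - cos b| <= `|a - b|.
Proof.
rewrite -[leRHS]mul1r.
apply: (@lipschitz_of_derive_bound cos (fun x => - sin x)) => x.
by rewrite normrN; exact: sin_max.
Qed.

Lemma normr_sin_le x : `|sin x| <= `|x|.
Proof. by have := dist_sin_le x 0; rewrite sin0 !subr0. Qed.

(** For [a <= b <= 0], write [e^b - e^a = e^b (1 - e^(a-b))]; the first factor is at most [1] and
    the second at most [b - a], by [1 + x <= e^x]. *)
Lemma dist_expR_le a b : a <= 0 -> b <= 0 -> `|expR a - expR b| <= `|a - b|.
Proof.
move=> a0 b0; wlog ab : a b a0 b0 / a <= b => [H|].
  have [/H|/ltW/H] := leP a b; first exact.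
  by rewrite distrC (distrC b); exact.
rewrite distrC (distrC a) !ger0_norm ?subr_ge0 ?ler_expR//.
have -> : expR a = expR b * expR (a - b) by rewrite -expRD addrC subrK.
have h1 : 1 + (a - b) <= expR (a - b) by exact: expR_ge1Dx.
have h2 : expR b <= 1 by rewrite -expR0 ler_expR.
have h3 : 0 <= expR b by exact: expR_ge0.
nra.
Qed.

Lemma cos_subr1_le x : `|cos x - 1| <= `|x|.
Proof. by have := dist_cos_le x 0; rewrite cos0 subr0. Qed.

Lemma sin_subr_le_lin x : `|sin x - x| <= 2 * `|x|.
Proof.
apply: (le_trans (ler_normB _ _)).
by have := normr_sin_le x; lra.
Qed.

(* Mean value theorem: both differences are [x] times a derivative taken at a
   point of modulus at most [|x|]. *)
Lemma cos_sin_quadratic x :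
  `|cos x - 1| <= x ^+ 2 /\ `|sin x - x| <= x ^+ 2.
Proof.
wlog x0 : x / 0 <= x => [H|].
  have [/H //|/ltW x0] := leP 0 x.
  have /H : 0 <= - x by rewrite oppr_ge0.
  by rewrite cosN sinN sqrrN -opprD normrN.
have hn : `|x| = x by rewrite ger0_norm.
split.
  have [c] := @MVT_segment R cos (fun x => - sin x) 0 x x0
    (fun x _ => is_derive_cos x)
    (derivable_within_continuous (fun x _ => @ex_derive _ _ _ _ _ _ _ (is_derive_cos x))).
  rewrite in_itv/= => /andP[c0 cx]; rewrite cos0 subr0 => ->.
  rewrite normrM normrN hn expr2 ler_wpM2r//.
  by rewrite (le_trans (normr_sin_le c))// ger0_norm.
have [c] := @MVT_segment R (fun y => sin y - y) (fun y => cos y - 1) 0 x x0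
  (fun x _ => is_deriveB (is_derive_sin x) (is_derive_id x 1))
  (derivable_within_continuous (fun x _ => @ex_derive _ _ _ _ _ _ _
    (is_deriveB (is_derive_sin x) (is_derive_id x 1)))).
rewrite in_itv/= => /andP[c0 cx]; rewrite sin0 !subr0 => ->.
rewrite normrM hn expr2 ler_wpM2r//.
by rewrite (le_trans (cos_subr1_le c))// ger0_norm.
Qed.

End elementary_bounds.

(** * Real-valued functions with an integrable bound *)

Section real_dominated_integral.
Context d (T : measurableType d) (R : realType) (mu : {measure set T -> \bar R}).
Implicit Types (D : set T) (f g : T -> R).

Lemma le_integrable_EFin D f g : measurable D -> measurable_fun D f ->
  mu.-integrable D (EFin \o g) -> (forall x, D x -> `|f x| <= g x) ->
  mu.-integrable D (EFin \o f).
Proof.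
move=> mD mf ig fg; apply: (le_integrable mD _ _ ig).
  exact/measurable_EFinP.
by move=> x Dx; rewrite /= lee_fin (le_trans (fg x Dx))// ler_norm.
Qed.

Lemma integrable_EFinD D f g : measurable D -> mu.-integrable D (EFin \o f) ->
  mu.-integrable D (EFin \o g) ->
  mu.-integrable D (EFin \o (fun x => f x + g x)).
Proof. by move=> mD fi gi; apply: eq_integrable (integrableD mD fi gi). Qed.

Lemma integrable_EFinB D f g : measurable D -> mu.-integrable D (EFin \o f) ->
  mu.-integrable D (EFin \o g) ->
  mu.-integrable D (EFin \o (fun x => f x - g x)).
Proof. by move=> mD fi gi; apply: eq_integrable (integrableB mD fi gi). Qed.

Lemma integrable_EFinZl D k f : measurable D -> mu.-integrable D (EFin \o f) ->
  mu.-integrable D (EFin \o (fun x => k * f x)).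
Proof. by move=> mD fi; apply: eq_integrable (integrableZl mD k fi). Qed.

Lemma normr_Rintegral_le D f g : measurable D -> measurable_fun D f ->
  mu.-integrable D (EFin \o g) -> (forall x, D x -> `|f x| <= g x) ->
  `|\int[mu]_(x in D) f x| <= \int[mu]_(x in D) g x.
Proof.
move=> mD mf ig fg.
have fi := le_integrable_EFin mD mf ig fg.
apply: (le_trans (le_normr_Rintegral mD fi)).
apply: le_Rintegral => //.
exact: integrable_norm.
Qed.

End real_dominated_integral.

(** * The arctangent as a sine integral *)

Section atan_integral.
Context {R : realType}.
Implicit Types t y : R.

Local Notation mu := (@lebesgue_measure R).

Lemma measurable_sin : measurable_fun [set: R] (@sin R).
Proof. by apply: continuous_measurable_fun; exact: continuous_sin. Qed.

Lemma measurable_cos : measurable_fun [set: R] (@cos R).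
Proof. by apply: continuous_measurable_fun; exact: continuous_cos. Qed.

Lemma measurable_atan : measurable_fun [set: R] (@atan R).
Proof. by apply: continuous_measurable_fun; exact: continuous_atan. Qed.

(** Inversion is continuous off [0], where it takes the default value [0]; the singleton is split
    off. *)
Lemma measurable_invr : measurable_fun [set: R] (@GRing.inv R).
Proof.
rewrite -(setUv [set 0]); apply/measurable_funU => //; first exact: measurableC.
split; first exact: measurable_fun_set1.
apply: open_continuous_measurable_fun.
  by apply: closed_openC; exact: closed_eq.
by move=> x /set_mem/= /eqP x0; exact: inv_continuous.
Qed.

Lemma integrable_expRN : mu.-integrable `[0, +oo[ (EFin \o (fun t => expR (- t))).
Proof.
have : mu.-integrable `[0, +oo[ (EFin \o @exponential_pdf R 1).
  by apply: integrableS (integrable_exponential_pdf ltr01).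
apply: eq_integrable => // t; rewrite inE/= in_itv/= andbT => t0.
by rewrite /= exponential_pdfE// mul1r mulN1r.
Qed.

Lemma Rintegral_expRN : \int[mu]_(t in `[0, +oo[) expR (- t) = 1.
Proof.
have <- : \int[mu]_t (exponential_pdf 1 t) = 1.
  by rewrite /Rintegral integral_exponential_pdf.
rewrite Rintegral_mkcond; apply: eq_Rintegral => t _.
rewrite /exponential_pdf !patchE; case: ifP => //.
by rewrite mul1r mulN1r.
Qed.

Lemma integrable_expRN_cos y :
  mu.-integrable `[0, +oo[ (EFin \o (fun t => expR (- t) * cos (t * y))).
Proof.
apply: (le_integrable_EFin _ _ integrable_expRN) => //.
  apply/measurable_funTS/measurable_funM; first exact: measurableT_comp.
  by apply: (measurableT_comp measurable_cos); exact: measurable_funM.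
by move=> t _; rewrite normrM ger0_norm ?expR_ge0// ler_piMr ?expR_ge0 ?cos_max.
Qed.

(** The fundamental theorem of calculus on a half-line is applied to a nonnegative integrand. Hence
    [e^(-t)], of integral [1], is added first and subtracted at the end. *)
Lemma Rintegral_expRN_cos y :
  \int[mu]_(t in `[0, +oo[) (expR (- t) * cos (t * y)) = (1 + y ^+ 2)^-1.
Proof.
have y1 : 0 < 1 + y ^+ 2 by rewrite ltr_wpDr ?sqr_ge0.
have ic := integrable_expRN_cos y.
pose F t := - expR (- t) + expR (- t) * (y * sin (t * y) - cos (t * y)) / (1 + y ^+ 2).
have dF t : is_derive t 1 F (expR (- t) * (1 + cos (t * y))).
  apply: is_derive_eq.
  rewrite /GRing.scale/=; field.
  by rewrite gt_eqF.
have i1 : \int[mu]_(t in `[0, +oo[) (expR (- t) * (1 + cos (t * y))) =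
     1 + (1 + y ^+ 2)^-1.
  rewrite /Rintegral (@ge0_continuous_FTC2y _ _ F _ 0).
  - rewrite -EFinB/= sub0r /F oppr0 expR0 mul0r sin0 cos0 mulr0 sub0r/=.
    by field; rewrite gt_eqF.
  - by move=> t _; rewrite mulr_ge0 ?expR_ge0// -lerBlDl sub0r cos_geN1.
  - apply: continuous_subspaceT => t.
    apply: cvgM.
      apply: continuous_comp; first exact: opp_continuous.
      exact: continuous_expR.
    apply: cvgD; first exact: cvg_cst.
    apply: continuous_comp; last exact: continuous_cos.
    by apply: cvgMl; exact: cvg_id.
  - apply: norm_cvg0.
    (* The primitive [F] is at most this multiple of [e^(-t)] in absolute value, so it vanishes at
       infinity. *)
    have : (1 + (`|y| + 1) / (1 + y ^+ 2)) * expR (- t) @[t --> +oo] --> (0 : R).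
      rewrite -[X in _ --> X](mulr0 (1 + (`|y| + 1) / (1 + y ^+ 2))).
      by apply: cvgMr; exact: cvgr_expR.
    apply: squeeze_cvgr (cvg_cst _) => //.
    near=> t; rewrite normr_ge0/=.
    rewrite /F mulrDl mul1r (le_trans (ler_normD _ _))//.
    rewrite normrN ger0_norm ?expR_ge0// lerD2l -mulrA normrM mulrC.
    rewrite (ger0_norm (expR_ge0 _)) ler_wpM2r ?expR_ge0//.
    rewrite normrM [X in _ * X]ger0_norm; last by rewrite invr_ge0 ltW.
    rewrite ler_pM2r ?invr_gt0// (le_trans (ler_normB _ _))// lerD ?cos_max//.
    by rewrite normrM ler_piMr// sin_max.
  - by move=> t _; exact: ex_derive.
  - apply: cvg_at_right_filter.
    apply: differentiable_continuous; apply/derivable1_diffP.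
    exact: ex_derive.
  - by move=> t _; rewrite derive1E; exact: derive_val.
have -> : (1 + y ^+ 2)^-1 = (1 + (1 + y ^+ 2)^-1) - 1 by lra.
rewrite -i1 -[X in _ - X]Rintegral_expRN -RintegralB//; last 2 first.
- have : mu.-integrable `[0, +oo[
      (fun t => (expR (- t))%:E + (expR (- t) * cos (t * y))%R%:E)%E.
    by apply: integrableD => //; exact: integrable_expRN.
  by apply: eq_integrable => // t _; rewrite /= mulrDr mulr1.
- exact: integrable_expRN.
by apply: eq_Rintegral => t _; lra.
Unshelve. all: end_near. Qed.


(** The bound [|sin (t y)| <= |t| |y|] cancels the singularity of [1 / t]. Using
    [exponential_pdf 1], which is [e^(-t)] for [t >= 0] and [0] for [t < 0], lets the integrals run
    over the whole line. *)
Lemma exponential_pdf_sin_bound t y :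
  `|exponential_pdf 1 t / t * sin (t * y)| <= `|y| * exponential_pdf 1 t.
Proof.
have e0 := exponential_pdf_ge0 (@ler01 R) t.
have [->|t0] := eqVneq t 0; first by rewrite mul0r sin0 mulr0 normr0 mulr_ge0// exponential_pdf_ge0.
rewrite normrM normrM normfV (ger0_norm e0) mulrC mulrCA mulrC ler_wpM2r//.
by rewrite ler_pdivrMr ?normr_gt0// -normrM (mulrC y) normr_sin_le.
Qed.

Lemma measurable_exponential_pdf_div :
  measurable_fun setT (fun t : R => exponential_pdf 1 t / t).
Proof.
apply: measurable_funM; first exact: measurable_exponential_pdf.
exact: measurable_invr.
Qed.

Lemma integrable_exponential_pdf_sin y :
  mu.-integrable setT (EFin \o (fun t => exponential_pdf 1 t / t * sin (t * y))).
Proof.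
have ig : mu.-integrable setT (EFin \o (fun t => `|y| * exponential_pdf 1 t)).
  by apply: integrable_EFinZl => //; exact: integrable_exponential_pdf.
apply: (le_integrable_EFin _ _ ig) => //.
- apply: measurable_funM; first exact: measurable_exponential_pdf_div.
  by apply: (measurableT_comp measurable_sin); exact: measurable_funM.
- by move=> t _; exact: exponential_pdf_sin_bound.
Qed.

(** Differentiating in [y] under the integral gives the integral of [e^(-t) cos (t y)] over the
    half-line, which is the derivative of [atan]; both sides vanish at [0]. *)
Lemma atan_integral y :
  \int[mu]_t (exponential_pdf 1 t / t * sin (t * y)) = atan y.
Proof.
pose F z := \int[mu]_t (exponential_pdf 1 t / t * sin (t * z)).
pose f z t : R := exponential_pdf 1 t / t * sin (t * z).
have df (z t : R) : is_derive z 1 (f^~ t) (exponential_pdf 1 t / t * (t * cos (t * z))).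
  by apply: is_derive_eq; rewrite /GRing.scale/=; ring.
have d1f (z t : R) : partial1of2 f z t = exponential_pdf 1 t / t * (t * cos (t * z)).
  by rewrite partial1of2E; exact: derive_val.
have dF (z : R) : is_derive z 1 F (1 + z ^+ 2)^-1.
  have zI : `]z - 1, z + 1[%classic z by rewrite /= in_itv/=; lra.
  have bG x t : `]z - 1, z + 1[%classic x -> setT t ->
      `|partial1of2 f x t| <= exponential_pdf 1 t.
    move=> _ _; rewrite d1f.
    have e0 := exponential_pdf_ge0 (@ler01 R) t.
    have [->|t0] := eqVneq t 0; first by rewrite mul0r mulr0 normr0 exponential_pdf_ge0.
    rewrite mulrA divfK// normrM (ger0_norm e0) ler_piMr//.
    exact: cos_max.
  have intf x : `]z - 1, z + 1[%classic x -> mu.-integrable setT (EFin \o f x).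
    by move=> _; exact: integrable_exponential_pdf_sin.
  have derf x t : `]z - 1, z + 1[%classic x -> setT t -> derivable (f^~ t) x 1.
    by move=> _ _; exact: ex_derive.
  have G0 := exponential_pdf_ge0 (@ler01 R).
  have iG := integrable_exponential_pdf (@ltr01 R).
  apply: DeriveDef.
    exact: (derivable_under_integral measurableT zI intf derf G0 iG bG).
  rewrite -derive1E.
  rewrite (differentiation_under_integral measurableT zI intf derf G0 iG bG).
  (* The point [t = 0] is dropped: there the differentiated integrand is [0], because [0^-1 = 0],
     while [e^(-t) cos (t z)] is [1]. *)
  rewrite -Rintegral_expRN_cos -Rintegral_itv_obnd_cbnd; last first.
    apply: integrableS (integrable_expRN_cos z) => //.
    by apply: subset_itvr; rewrite bnd_simp.
  rewrite [RHS]Rintegral_mkcond; apply: eq_Rintegral => t _.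
  rewrite d1f patchE; case: ifPn.
    rewrite inE/= in_itv/= andbT => t0.
    rewrite exponential_pdfE ?ltW// mul1r mulN1r mulrA divfK//.
    by rewrite gt_eqF.
  rewrite notin_setE/= in_itv/= andbT => /negP; rewrite -leNgt le_eqVlt.
  move=> /predU1P[->|t0]; first by rewrite mul0r mulr0.
  by rewrite lt0_exponential_pdf// !mul0r.
have dFa (z : R) : is_derive z 1 (fun x => F x - atan x) 0.
  by apply: is_derive_eq; rewrite subrr.
have F0 : F 0 = 0.
  rewrite /F; under eq_Rintegral do rewrite mulr0 sin0 mulr0.
  by rewrite /Rintegral integral0.
have := is_derive_0_is_cst y 0 dFa.
by rewrite F0 atan0 subrr => /eqP; rewrite subr_eq0 => /eqP.
Qed.

End atan_integral.

(** * Smoothing *)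

Section smoothing.
Context {R : realType}.
Local Notation mu := (@lebesgue_measure R).

Lemma bounded_integrable d (T : measurableType d) (P : probability T R)
    (f : T -> R) (k : R) :
  measurable_fun setT f -> (forall w, `|f w| <= k) ->
  P.-integrable setT (EFin \o f).
Proof.
move=> mf fk; apply: (@le_integrable_EFin _ _ _ _ _ _ (cst k)) => //.
exact: finite_measure_integrable_cst.
Qed.

(** Fubini applied to the sine integral of [atan (Y w)]. The integrand is bounded by [|Y w|] times
    the exponential density, so the finite first moment of [Y] makes it integrable on the
    product. *)
Lemma Rintegral_atan_sin d (T : measurableType d) (P : probability T R)
    (Y : T -> R) : P.-integrable setT (EFin \o Y) ->
  mu.-integrable setT
    (EFin \o (fun t => exponential_pdf 1 t / t * \int[P]_w sin (t * Y w))) /\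
  \int[P]_w atan (Y w) =
  \int[mu]_t (exponential_pdf 1 t / t * \int[P]_w sin (t * Y w)).
Proof.
move=> iY.
have mY : measurable_fun setT Y by apply/measurable_EFinP; exact: measurable_int iY.
have ms t : measurable_fun setT (fun w => sin (t * Y w)).
  by apply: (measurableT_comp measurable_sin); exact: measurable_funM.
have isn t : P.-integrable setT (EFin \o (fun w => sin (t * Y w))).
  by apply: (@bounded_integrable _ _ _ _ 1) => // w; exact: sin_max.
pose f (z : measurableTypeR R * T) := (exponential_pdf 1 z.1 / z.1 * sin (z.1 * Y z.2))%:E.
have mf : measurable_fun setT f.
  apply/measurable_EFinP/measurable_funM.
    exact: (measurableT_comp measurable_exponential_pdf_div).
  apply: (measurableT_comp measurable_sin); apply: measurable_funM => //.
  exact: measurableT_comp.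
have iF : (mu \x P)%E.-integrable setT f.
  apply: (proj2 (@integrable21ltyP _ _ _ _ _ mu P f mf)).
  apply: (@le_lt_trans _ _ (\int[P]_w `|Y w|%:E)%E).
    apply: ge0_le_integral => //.
    - by move=> w _; exact: integral_ge0.
    - apply: (@measurable_fun_fubini_tonelli_G _ _ _ _ _ mu (abse \o f)) => //.
        exact: measurableT_comp.
      by move=> z; exact: abse_ge0.
    - by apply/measurable_EFinP; exact: measurableT_comp.
    move=> w _.
    apply: (@le_trans _ _ (\int[mu]_t (`|Y w|%:E * (exponential_pdf 1 t)%:E))%E).
      apply: ge0_le_integral => //.
      - apply: measurableT_comp => //.
        by apply: measurableT_comp => //; exact: measurable_pair2.
      - apply/measurable_EFinP/measurable_funM => //.
        exact: measurable_exponential_pdf.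
      by move=> t _; rewrite lee_fin exponential_pdf_sin_bound.
    rewrite ge0_integralZl//.
    - by rewrite integral_exponential_pdf// mule1.
    - by apply/measurable_EFinP; exact: measurable_exponential_pdf.
    by move=> t _; rewrite lee_fin exponential_pdf_ge0.
  by move/integrableP : iY => [].
have fE t : (\int[P]_w f (t, w) =
    (exponential_pdf 1 t / t * \int[P]_w sin (t * Y w))%R%:E)%E.
  rewrite /f/=; under eq_integral do rewrite EFinM.
  rewrite integralZl//; last exact: isn.
  by rewrite [RHS]EFinM /Rintegral fineK//; apply: integrable_fin_num => //; exact: isn.
split.
  apply: eq_integrable (integrable_fubini_F iF) => // t _.
  by rewrite /fubini_F fE.
rewrite /Rintegral; congr fine.
rewrite (_ : (\int[P]_w (atan (Y w))%:E)%E =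
    (\int[P]_w \int[mu]_t f (t, w))%E); last first.
  apply: eq_integral => w _; rewrite -atan_integral /Rintegral fineK//.
  by apply: integrable_fin_num => //; exact: integrable_exponential_pdf_sin.
by rewrite -(Fubini iF); apply: eq_integral => t _; rewrite fE.
Qed.

Lemma expectation_atan_dist d1 (T1 : measurableType d1) (P1 : probability T1 R)
    d2 (T2 : measurableType d2) (P2 : probability T2 R)
    (Y1 : T1 -> R) (Y2 : T2 -> R) (a b : R) :
  P1.-integrable setT (EFin \o Y1) -> P2.-integrable setT (EFin \o Y2) ->
  0 <= a -> 0 <= b ->
  (forall t, 0 <= t ->
    `|\int[P1]_w sin (t * Y1 w) - \int[P2]_w sin (t * Y2 w)|
    <= a * t + b * t ^+ 2) ->
  `|\int[P1]_w atan (Y1 w) - \int[P2]_w atan (Y2 w)| <= a + 4 * b.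
Proof.
move=> iY1 iY2 a0 b0 hab.
have [i1 ->] := Rintegral_atan_sin iY1.
have [i2 ->] := Rintegral_atan_sin iY2.
rewrite -RintegralB//.
(* After division by [t] the integrand is at most [a e^(-t) + b t e^(-t)]. Since [t e^(-t/2) <= 2],
   the term [t e^(-t)] is at most [4] times the exponential density of rate [1/2], whose mass is
   [1]. *)
pose g t := a * exponential_pdf 1 t + (4 * b) * exponential_pdf (2^-1) t.
have h2 : 0 < 2^-1 :> R by rewrite invr_gt0.
have j1 := integrable_exponential_pdf (@ltr01 R).
have j2 := integrable_exponential_pdf h2.
have ig : mu.-integrable setT (EFin \o g).
  by apply: integrable_EFinD => //; exact: integrable_EFinZl.
have <- : \int[mu]_t g t = a + 4 * b.
  rewrite RintegralD//; [|exact: integrable_EFinZl..].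
  rewrite !RintegralZl// /Rintegral !integral_exponential_pdf//.
  by rewrite !mulr1.
apply: normr_Rintegral_le => //.
  by apply: measurable_funB; apply/measurable_EFinP; [exact: measurable_int i1|exact: measurable_int i2].
move=> t _; rewrite -mulrBr normrM.
have e0 := exponential_pdf_ge0 (@ler01 R) t.
have e2 := exponential_pdf_ge0 (ltW h2) t.
have [t0|t0] := leP t 0.
  (* For [t < 0] the density vanishes; at [t = 0] the quotient is [0] by the convention on
     inverses. *)
  have -> : exponential_pdf 1 t / t = 0.
    move: t0; rewrite le_eqVlt => /predU1P[->|t0]; first by rewrite invr0 mulr0.
    by rewrite lt0_exponential_pdf// mul0r.
  by rewrite normr0 mul0r /g addr_ge0// !mulr_ge0.
rewrite normrM (ger0_norm e0) normfV (gtr0_norm t0).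
rewrite -mulrA mulrC -[leRHS]mul1r.
apply: (@le_trans _ _ (((a * t + b * t ^+ 2) / t) * exponential_pdf 1 t)).
  by rewrite ler_wpM2r// mulrC ler_pM2r ?invr_gt0// hab// ltW.
have -> : (a * t + b * t ^+ 2) / t = a + b * t by field; rewrite gt_eqF.
rewrite mul1r mulrDl lerD2l.
rewrite !exponential_pdfE; [|exact: ltW..]; rewrite mul1r mulN1r.
have -> : expR (- t) = expR (- 2^-1 * t) * expR (- 2^-1 * t).
  by rewrite -expRD; congr expR; lra.
set e := expR (- 2^-1 * t).
have -> : b * t * (e * e) = (b * e) * (t * e) by ring.
have -> : 4 * b * (2^-1 * e) = (b * e) * 2 by field.
apply: ler_wpM2l; first by rewrite mulr_ge0// expR_ge0.
rewrite /e mulNr expRN ler_pdivrMr ?expR_gt0//.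
by have := expR_ge1Dx (2^-1 * t); lra.
Qed.

End smoothing.

(** * Comparison of tail functions through the arctangent *)

Section bootstrap.
Context {R : realType}.
Local Notation mu := (@lebesgue_measure R).

(** The sublevel set of [h] is closed and downward closed, so when nonempty and bounded above it
    contains its supremum. The half-line obtained is open at [a], which matches the strict
    inequality in [ccdf]. *)
Lemma nondecreasing_superlevel (h : R -> R) (r : R) :
  continuous h -> {homo h : x y / x <= y} ->
  [\/ h @^-1` `]r, +oo[ = set0, h @^-1` `]r, +oo[ = setT |
      exists a, h @^-1` `]r, +oo[ = `]a, +oo[%classic].
Proof.
move=> ch hh; pose L := [set y | h y <= r].
have LP y : (h @^-1` `]r, +oo[) y <-> ~ L y.
  by rewrite /L /= in_itv/= andbT ltNge; split => /negP.
have [L0|/set0P [y0 Ly0]] := eqVneq L set0.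
  by apply: Or32; apply/seteqP; split => y // _; apply/LP; rewrite L0.
have [Lub|Lub] := pselect (has_ubound L); last first.
  apply: Or31; apply/seteqP; split => y //= /LP nLy; exfalso; apply: Lub.
  exists y => z Lz; rewrite leNgt; apply/negP => /ltW/hh yz; apply: nLy.
  exact: (le_trans yz Lz).
apply: Or33; exists (sup L); apply/seteqP; split => y /=.
  move=> /LP Ly; rewrite in_itv/= andbT ltNge; apply/negP => ysup; apply: Ly.
  have : closure L (sup L) by apply: closure_sup => //; exists y0.
  have : closed L by move/continuous_closedP : ch => /(_ _ (@closed_le _ r)).
  by rewrite closure_id => <- /= /(le_trans (hh _ _ ysup)).
rewrite in_itv/= andbT => supy; apply/LP => Ly.
by have := ub_le_sup Lub Ly; rewrite leNgt supy.
Qed.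

(** Layer-cake formula: the mean of [h (X)] is the integral over [r >= 0] of the probability that
    [h (X) > r]. Each such event is empty, full or of the form [X > a], so it costs at most [eta],
    and only levels [r] in [[0, c]] contribute. *)
Lemma Rintegral_nondecreasing_le d1 (T1 : measurableType d1)
    (P1 : probability T1 R) d2 (T2 : measurableType d2) (P2 : probability T2 R)
    (X : {RV P1 >-> R}) (Y : {RV P2 >-> R}) (h : R -> R) (c eta : R) :
  continuous h -> {homo h : x y / x <= y} -> (forall y, 0 <= h y <= c) ->
  0 <= eta -> (forall a, (ccdf X a <= ccdf Y a + eta%:E)%E) ->
  \int[P1]_w h (X w) <= \int[P2]_w h (Y w) + c * eta.
Proof.
move=> ch hh h0c eta0 XY.
have mh : measurable_fun setT h by exact: continuous_measurable_fun.
have mX : measurable_fun setT (h \o X) by exact: measurableT_comp.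
have mY : measurable_fun setT (h \o Y) by exact: measurableT_comp.
pose Zx : {RV P1 >-> R} := mfun_Sub (mem_set mX).
pose Zy : {RV P2 >-> R} := mfun_Sub (mem_set mY).
have c0 : 0 <= c by have /andP[] := h0c 0; exact: le_trans.
have key r : 0 <= r -> (ccdf Zx r <= ccdf Zy r + (eta * \1_(`[0, c] : set R) r)%:E)%E.
  move=> r0; rewrite /ccdf /distribution /pushforward/=.
  have [cr|rc] := leP c r.
    rewrite (_ : (h \o X) @^-1` _ = set0) ?measure0.
      by rewrite adde_ge0 ?measure_ge0// lee_fin mulr_ge0.
    apply/seteqP; split => w //=; rewrite in_itv/= andbT ltNge => /negP; apply.
    by have /andP[_ hc] := h0c (X w); exact: le_trans cr.
  have -> : \1_(`[0, c] : set R) r = 1 :> R.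
    by rewrite indicE mem_set//= in_itv/= r0 (ltW rc).
  rewrite mulr1.
  have -> : (h \o X) @^-1` `]r, +oo[ = X @^-1` (h @^-1` `]r, +oo[) by [].
  have -> : (h \o Y) @^-1` `]r, +oo[ = Y @^-1` (h @^-1` `]r, +oo[) by [].
  have [->|->|[a ->]] := nondecreasing_superlevel r ch hh.
  - by rewrite !preimage_set0 !measure0 add0e lee_fin.
  - by rewrite !preimage_setT !probability_setT leeDl.
  - exact: XY.
have bX w : `|h (X w)| <= c by have /andP[h0 hc] := h0c (X w); rewrite ger0_norm.
have bY w : `|h (Y w)| <= c by have /andP[h0 hc] := h0c (Y w); rewrite ger0_norm.
have iX := bounded_integrable P1 mX bX.
have iY := bounded_integrable P2 mY bY.
rewrite -lee_fin EFinD /Rintegral !fineK; [|exact: integrable_fin_num..].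
have := @ge0_expectation_ccdf _ _ _ _ Zx; rewrite unlock => ->; last first.
  by move=> w; have /andP[] := h0c (X w).
have := @ge0_expectation_ccdf _ _ _ _ Zy; rewrite unlock => ->; last first.
  by move=> w; have /andP[] := h0c (Y w).
apply: (@le_trans _ _ (\int[mu]_(r in `[0%R, +oo[)
    (ccdf Zy r + (eta * \1_(`[0, c] : set R) r)%:E))%E).
  apply: ge0_le_integral => //.
  - by apply: measurable_funTS; exact: ccdf_measurable.
  - apply: emeasurable_funD; first by apply: measurable_funTS; exact: ccdf_measurable.
    exact/measurable_EFinP/measurable_funM.
  - by move=> r; rewrite /= in_itv/= andbT; exact: key.
rewrite ge0_integralD//; last 3 first.
- by apply: measurable_funTS; exact: ccdf_measurable.
- by move=> r _; rewrite lee_fin mulr_ge0.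
- exact/measurable_EFinP/measurable_funM.
rewrite leeD2l//.
under eq_integral do rewrite EFinM.
rewrite ge0_integralZl//; last first.
  exact/measurable_EFinP.
rewrite integral_indic//.
rewrite muleC EFinM lee_wpmul2r//.
rewrite (_ : _ `&` _ = `[0, c]%classic).
  have muc : mu `[0, c] = c%:E.
    rewrite lebesgue_measure_itv/= lte_fin; case: ltgtP c0 => // [_ _|<- _//].
    by rewrite sube0.
  by move: (lexx c%:E); rewrite -{1}muc.
apply/seteqP; split => r /=; rewrite !in_itv/= andbT; first by case.
by move=> /andP[r0 rc]; split=> //; rewrite r0.
Qed.

Lemma Rintegral_ccdf d (T : measurableType d) (P : probability T R)
    (Z : {RV P >-> R}) (a : R) :
  P.-integrable setT (EFin \o (fun w => \1_(`]a, +oo[ : set R) (Z w))) /\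
  \int[P]_w \1_(`]a, +oo[ : set R) (Z w) = fine (ccdf Z a).
Proof.
have mZ : measurable (Z @^-1` `]a, +oo[) by exact: measurable_funPTI.
split; first exact: integrable_indic.
rewrite /Rintegral.
have -> : (fun w => (\1_(`]a, +oo[ : set R) (Z w))%:E) =
  (fun w => (\1_(Z @^-1` `]a, +oo[) w)%:E) by [].
by rewrite integral_indic// setIT.
Qed.

(* [atan] is the sum of its truncation at [atan 2] and of [tail], which is
   nondecreasing of total variation [pi - 2 * atan 2]; the latter is absorbed by
   the left-hand side because [pi < 4 * atan 2]. *)
Lemma ccdf_bootstrap d1 (T1 : measurableType d1) (P1 : probability T1 R)
    d2 (T2 : measurableType d2) (P2 : probability T2 R)
    (X : {RV P1 >-> R}) (Y : {RV P2 >-> R}) (delta x eta : R) :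
  0 < delta -> 0 <= eta ->
  (forall a, (ccdf Y a <= ccdf X a + eta%:E)%E) ->
  2 * atan 2 * (fine (ccdf X (x + 2 * delta)) - fine (ccdf Y (x - 2 * delta))) <=
  (\int[P1]_w atan ((X w - x) / delta) - \int[P2]_w atan ((Y w - x) / delta)) +
  (pi - 2 * atan 2) * eta.
Proof.
move=> d0 eta0 YX.
pose z y := (y - x) / delta.
(* On [-2 <= z y <= 2] this is constant, so [atan (z y) - tail y] is a truncated arctangent up to a
   constant. The constant [pi / 2 - atan 2] puts the values of [tail] in [[0, pi - 2 * atan 2]], as
   the layer-cake bound requires. *)
pose tail y := atan (Num.max (z y) 2) + atan (Num.min (z y) (- 2)) + (pi / 2 - atan 2).
have z_ge y : (2 <= z y) = (x + 2 * delta <= y).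
  by rewrite /z ler_pdivlMr// lerBrDl.
have z_le y : (z y <= - 2) = (y <= x - 2 * delta).
  by rewrite /z ler_pdivrMr// lerBlDl mulNr.
have z_mono : {homo z : u v / u <= v}.
  by move=> u v uv; rewrite /z ler_pM2r ?invr_gt0// lerB.
have cz : continuous z.
  by move=> y; apply: cvgMl; apply: cvgB; [exact: cvg_id|exact: cvg_cst].
have ct : continuous tail.
  move=> y; apply: cvgD; last exact: cvg_cst.
  apply: cvgD; apply: continuous_comp; try exact: continuous_atan.
    by apply: continuous_max; [exact: cz|exact: cst_continuous].
  by apply: continuous_min; [exact: cz|exact: cst_continuous].
have tail_mono : {homo tail : u v / u <= v}.
  move=> u v uv; rewrite /tail lerD2r lerD// le_atan//.
    by rewrite ge_max le_max z_mono//= le_max lexx orbT.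
  by rewrite le_min ge_min z_mono//= ge_min lexx orbT.
have tail_bnd y : 0 <= tail y <= pi - 2 * atan 2.
  have h1 : atan 2 <= atan (Num.max (z y) 2) by apply: le_atan; rewrite le_max lexx orbT.
  have h2 : atan (Num.min (z y) (- 2)) <= - atan 2.
    by rewrite -atanN; apply: le_atan; rewrite ge_min lexx orbT.
  have h3 := atan_ltpi2 (Num.max (z y) 2).
  have h4 := atan_gtNpi2 (Num.min (z y) (- 2)).
  by rewrite /tail; lra.
have A0 : 0 < atan 2 :> R by rewrite -atan0 lt_atan.
(* The truncated arctangent stays within [atan 2] of [0] and equals [atan 2] once
   [y >= x + 2 * delta] and [- atan 2] once [y <= x - 2 * delta]. It thus lies between two step
   functions with these jump points. *)
have bounds y :
    atan 2 * (2 * \1_(`]x + 2 * delta, +oo[ : set R) y - 1) <=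
      atan (z y) - (tail y - (pi / 2 - atan 2)) <=
    atan 2 * (2 * \1_(`]x - 2 * delta, +oo[ : set R) y - 1).
  have indE a : \1_(`]a, +oo[ : set R) y = (a < y)%R%:R :> R.
    by rewrite indicE mem_setE in_itv/= andbT.
  rewrite !indE.
  have hA : 2 <= z y -> atan (z y) - (tail y - (pi / 2 - atan 2)) = atan 2.
    move=> z2; rewrite /tail max_l// min_r; last by rewrite (le_trans _ z2)//; lra.
    by rewrite atanN; lra.
  have hNA : z y <= - 2 -> atan (z y) - (tail y - (pi / 2 - atan 2)) = - atan 2.
    move=> z2; rewrite /tail min_l// max_r; last by rewrite (le_trans z2)//; lra.
    by lra.
  have hS : - atan 2 <= atan (z y) - (tail y - (pi / 2 - atan 2)) <= atan 2.
    have [/hA ->|z2] := leP 2 (z y); first by lra.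
    have [/hNA ->|zN2] := leP (z y) (- 2); first by lra.
    rewrite /tail max_r ?(ltW z2)// min_r ?(ltW zN2)// atanN.
    have := le_atan (ltW z2); have := le_atan (ltW zN2); rewrite atanN.
    by lra.
  apply/andP; split.
    have [xy|_] := ltP (x + 2 * delta) y; last by case/andP: hS => ? ? /=; rewrite mulr0n; lra.
    by rewrite hA ?z_ge ?(ltW xy)//= mulr1n; lra.
  have [_|xy] := ltP (x - 2 * delta) y; first by case/andP: hS => ? ? /=; rewrite mulr1n; lra.
  by rewrite hNA ?z_le//= mulr0n; lra.
have mt : measurable_fun setT tail by exact: continuous_measurable_fun.
have mz : measurable_fun setT (fun y => atan (z y)).
  by apply: measurableT_comp; [exact: measurable_atan|exact: continuous_measurable_fun].
have intg d (T : measurableType d) (P : probability T R) (Z : {RV P >-> R}) :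
  [/\ P.-integrable setT (EFin \o (fun w => tail (Z w))),
      P.-integrable setT (EFin \o (fun w => atan (z (Z w)))),
      atan 2 * (2 * fine (ccdf Z (x + 2 * delta)) - 1) <=
        \int[P]_w atan (z (Z w)) - (\int[P]_w tail (Z w) - (pi / 2 - atan 2)) &
      \int[P]_w atan (z (Z w)) - (\int[P]_w tail (Z w) - (pi / 2 - atan 2)) <=
        atan 2 * (2 * fine (ccdf Z (x - 2 * delta)) - 1)].
  have it : P.-integrable setT (EFin \o (fun w => tail (Z w))).
    apply: (@bounded_integrable _ _ _ _ _ (pi - 2 * atan 2)).
      exact: measurableT_comp.
    by move=> w; have /andP[t0 tc] := tail_bnd (Z w); rewrite ger0_norm.
  have ia : P.-integrable setT (EFin \o (fun w => atan (z (Z w)))).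
    apply: (@bounded_integrable _ _ _ _ _ (pi / 2)).
      exact: (measurableT_comp mz).
    by move=> w; rewrite ler_norml !ltW ?atan_gtNpi2 ?atan_ltpi2.
  have cI k : P.-integrable setT (EFin \o cst k).
    exact: finite_measure_integrable_cst.
  have cE k : \int[P]_w (cst k w : R) = k.
    by rewrite Rintegral_cst//= probability_setT mulr1.
  have iS : P.-integrable setT
      (EFin \o (fun w => atan (z (Z w)) - (tail (Z w) - (pi / 2 - atan 2)))).
    by apply: integrable_EFinB => //; apply: integrable_EFinB => //; exact: cI.
  have SE : \int[P]_w atan (z (Z w)) - (\int[P]_w tail (Z w) - (pi / 2 - atan 2)) =
      \int[P]_w (atan (z (Z w)) - (tail (Z w) - (pi / 2 - atan 2))).
    rewrite RintegralB//; last by apply: integrable_EFinB => //; exact: cI.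
    by rewrite RintegralB//; [rewrite cE|exact: cI].
  have iI a : P.-integrable setT
      (EFin \o (fun w => atan 2 * (2 * \1_(`]a, +oo[ : set R) (Z w) - 1))).
    have [i1 _] := Rintegral_ccdf Z a.
    apply: integrable_EFinZl => //; apply: integrable_EFinB => //; last exact: cI.
    exact: integrable_EFinZl.
  have IE a : \int[P]_w (atan 2 * (2 * \1_(`]a, +oo[ : set R) (Z w) - 1)) =
      atan 2 * (2 * fine (ccdf Z a) - 1).
    have [i1 iE] := Rintegral_ccdf Z a.
    rewrite RintegralZl//; last first.
      by apply: integrable_EFinB => //; [exact: integrable_EFinZl|exact: cI].
    rewrite RintegralB//; [|exact: integrable_EFinZl|exact: cI].
    by rewrite cE RintegralZl// iE.
  rewrite SE -!IE; split => //; apply: le_Rintegral => // w _.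
    by have /andP[] := bounds (Z w).
  by have /andP[] := bounds (Z w).
have [itX iaX lX uX] := intg _ _ _ X.
have [itY iaY lY uY] := intg _ _ _ Y.
have : \int[P2]_w tail (Y w) <= \int[P1]_w tail (X w) + (pi - 2 * atan 2) * eta.
  exact: (@Rintegral_nondecreasing_le _ _ _ _ _ _ Y X tail).
by move: lX uY; rewrite /z; lra.
Qed.

End bootstrap.

(** * Absorption of the supremum into the left-hand side *)

Section kolmogorov_distance.
Context {R : realType}.

(** As [atan 1 = pi / 4], any truncation level above [1] would allow the absorption; [2] is one
    choice. *)
Lemma pi_lt_4atan2 : pi < 4 * atan 2 :> R.
Proof.
have := @lt_atan R 1 2; rewrite atan1 ltr1n => /(_ isT).
by rewrite ltr_pdivrMr// mulrC.
Qed.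

(** With [eta] the supremum distance, the bootstrap gives [(4 * atan 2 - pi) * eta <= 11 * (D /
    delta ^+ 2) + 8 * atan 2 * M * delta]. The sum of the coefficients [11] and [8 * atan 2] serves
    for both terms. *)
Definition smoothing_constant : R := (11 + 8 * atan 2) / (4 * atan 2 - pi).

Lemma smoothing_constant_gt0 : 0 < smoothing_constant.
Proof.
have h := pi_lt_4atan2; have p := pi_gt0 R.
by apply: divr_gt0; lra.
Qed.

Lemma ccdf_smoothing d1 (T1 : measurableType d1) (P1 : probability T1 R)
    d2 (T2 : measurableType d2) (P2 : probability T2 R)
    (X : {RV P1 >-> R}) (Y : {RV P2 >-> R}) (D M delta : R) :
  P1.-integrable setT (EFin \o X) -> P2.-integrable setT (EFin \o Y) ->
  0 <= D -> 0 <= M -> 0 < delta <= 1 ->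
  (forall x s, 0 <= s -> fine (ccdf Y x) - fine (ccdf Y (x + s)) <= M * s) ->
  (forall t x, 0 <= t ->
    `|\int[P1]_w sin (t * (X w - x)) - \int[P2]_w sin (t * (Y w - x))|
    <= D * (3 * t + 2 * t ^+ 2)) ->
  forall x, `|fine (ccdf X x) - fine (ccdf Y x)| <=
    smoothing_constant * (D / delta ^+ 2 + M * delta).
Proof.
move=> iX iY D0 M0 /andP[d0 d1'] lipY hsin.
have atanXY x : `|\int[P1]_w atan ((X w - x) / delta) -
    \int[P2]_w atan ((Y w - x) / delta)| <= 11 * (D / delta ^+ 2).
  have aff d (T : measurableType d) (P : probability T R) (Z : T -> R) :
      P.-integrable setT (EFin \o Z) ->
      P.-integrable setT (EFin \o (fun w => (Z w - x) / delta)).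
    move=> iZ; have : P.-integrable setT (EFin \o (fun w => delta^-1 * (Z w - x))).
      apply: integrable_EFinZl => //; apply: integrable_EFinB => //.
      exact: finite_measure_integrable_cst.
    by apply: eq_integrable => // w _; rewrite /= mulrC.
  (* Rescaling by [delta] turns [3 t + 2 t^2] into coefficients [3 / delta] and [2 / delta^2]. As
     [delta <= 1], the total is at most [3 + 8 = 11] times [D / delta^2]. *)
  apply: (@le_trans _ _ (3 * D / delta + 4 * (2 * D / delta ^+ 2))).
    apply: expectation_atan_dist; [exact: aff|exact: aff| | |].
    - by rewrite divr_ge0 ?mulr_ge0// ltW.
    - by apply: divr_ge0; [exact: mulr_ge0|exact: sqr_ge0].
    move=> t t0.
    have -> : 3 * D / delta * t + 2 * D / delta ^+ 2 * t ^+ 2 =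
        D * (3 * (t / delta) + 2 * (t / delta) ^+ 2) by field; rewrite gt_eqF.
    rewrite (_ : (fun w => sin (t * ((X w - x) / delta))) =
      (fun w => sin (t / delta * (X w - x)))); last first.
      by apply/funext => w; congr sin; ring.
    rewrite (_ : (fun w => sin (t * ((Y w - x) / delta))) =
      (fun w => sin (t / delta * (Y w - x)))); last first.
      by apply/funext => w; congr sin; ring.
    by apply: hsin; rewrite divr_ge0// ltW.
  have h : D / delta <= D / delta ^+ 2.
    rewrite ler_wpM2l// lef_pV2 ?posrE ?exprn_gt0//.
    by rewrite expr2 ler_piMr// ltW.
  by rewrite -!mulrA; move: h; lra.
have g01 d (T : measurableType d) (P : probability T R) (Z : {RV P >-> R}) a :
    0 <= fine (ccdf Z a) <= 1.
  rewrite fine_ge0/= ?measure_ge0// -lee_fin fineK ?fin_num_measure//.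
  exact: probability_le1.
pose E : set R := range (fun x => `|fine (ccdf X x) - fine (ccdf Y x)|).
(* The distances are at most [1], so this supremum is finite and a multiple of it can be moved
   across the inequality. *)
pose eta := sup E.
have ubE : has_ubound E.
  exists 1 => _ [x _ <-]; have := g01 _ _ _ X x; have := g01 _ _ _ Y x.
  by rewrite ler_norml; lra.
have le_eta x : `|fine (ccdf X x) - fine (ccdf Y x)| <= eta.
  by apply: ub_le_sup => //; exists x.
have eta0 : 0 <= eta by apply: le_trans (le_eta 0).
have A0 : 0 < atan 2 :> R by rewrite -atan0 lt_atan.
have leD d (T : measurableType d) (P : probability T R)
    d' (T' : measurableType d') (P' : probability T' R)
    (Z : {RV P >-> R}) (Z' : {RV P' >-> R}) a :
    fine (ccdf Z a) - fine (ccdf Z' a) <= eta -> (ccdf Z a <= ccdf Z' a + eta%:E)%E.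
  have fZ : ccdf Z a \is a fin_num by rewrite fin_num_measure.
  have fZ' : ccdf Z' a \is a fin_num by rewrite fin_num_measure.
  by rewrite -(fineK fZ) -(fineK fZ') -EFinD lee_fin; lra.
have step x : 2 * atan 2 * (`|fine (ccdf X x) - fine (ccdf Y x)| - 4 * delta * M)
    <= 11 * (D / delta ^+ 2) + (pi - 2 * atan 2) * eta.
  have hXY a : (ccdf X a <= ccdf Y a + eta%:E)%E.
    by apply: leD; have := le_eta a; rewrite ler_norml => /andP[].
  have hYX a : (ccdf Y a <= ccdf X a + eta%:E)%E.
    by apply: leD; have := le_eta a; rewrite ler_norml => /andP[]; lra.
  (* The centre [x - 2 * delta] or [x + 2 * delta] is chosen according to the sign, so that [X] is
     always evaluated at [x] itself and [Y] at distance [4 * delta] from [x]. Only the tail of [Y]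
     then has to be moved, at the price [4 * delta * M]. *)
  have [XY|YX] := leP (fine (ccdf Y x)) (fine (ccdf X x)).
    have := ccdf_bootstrap (x - 2 * delta) d0 eta0 hYX.
    have := lipY (x - 4 * delta) (4 * delta).
    rewrite (_ : x - 2 * delta - 2 * delta = x - 4 * delta); last by ring.
    rewrite !subrK.
    have := atanXY (x - 2 * delta); rewrite ler_norml ger0_norm ?subr_ge0//.
    move=> /andP[_ h1] h2 h3.
    have {}h2 := h2 (ltac:(lra)).
    apply: le_trans (_ : _ <= 2 * atan 2 * (fine (ccdf X x) -
      fine (ccdf Y (x - 4 * delta)))) _; last lra.
    by rewrite ler_wpM2l//; lra.
  have := ccdf_bootstrap (x + 2 * delta) d0 eta0 hXY.
  have := lipY x (4 * delta).
  rewrite (_ : x + 2 * delta + 2 * delta = x + 4 * delta); last by ring.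
  rewrite addrK.
  have := atanXY (x + 2 * delta); rewrite ler_norml ltr0_norm ?subr_lt0//.
  move=> /andP[h1 _] h2 h3.
  have {}h2 := h2 (ltac:(lra)).
  apply: le_trans (_ : _ <= 2 * atan 2 * (fine (ccdf Y (x + 4 * delta)) -
      fine (ccdf X x))) _; last lra.
  by rewrite ler_wpM2l//; lra.
have : eta <= (11 * (D / delta ^+ 2) + (pi - 2 * atan 2) * eta) / (2 * atan 2) +
     4 * delta * M.
  apply: sup_le_ub; first by exists `|fine (ccdf X 0) - fine (ccdf Y 0)|; exists 0.
  move=> _ [x _ <-]; rewrite -lerBlDr ler_pdivlMr; last by rewrite mulr_gt0.
  by rewrite mulrC; exact: step.
rewrite -lerBlDr ler_pdivlMr; last by rewrite mulr_gt0.
move=> heta x; apply: (le_trans (le_eta x)).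
have k0 : 0 < 4 * atan 2 - pi :> R by have := pi_lt_4atan2; lra.
rewrite /smoothing_constant mulrAC ler_pdivlMr//.
have Md : 0 <= M * delta by rewrite mulr_ge0// ltW.
have Dd : 0 <= D / delta ^+ 2 by rewrite divr_ge0 ?sqr_ge0.
have h1 : 0 <= atan 2 * (D / delta ^+ 2) by rewrite mulr_ge0// ltW.
move: heta h1 Md Dd; set a := atan 2; set q := D / _ => heta h1 Md Dd.
by nra.
Qed.

End kolmogorov_distance.

(** * Measures with a density *)

Section density.
Context {R : realType}.
Local Notation mu := (@lebesgue_measure R).

Section change_of_density.
Variables (m : {measure set R -> \bar R}) (f : R -> R).
Hypotheses (mf : measurable_fun setT f) (f0 : forall x, 0 <= f x)
  (mE : has_density m f).

Import HBNNSimple.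

Let integral_nnsfun_density (h : {nnsfun R >-> R}) :
  (\int[m]_x (h x)%:E = \int[mu]_x ((h x)%:E * (f x)%:E))%E.
Proof.
have h0 y x : (0 <= (y * \1_(h @^-1` [set y]) x)%:E :> \bar R)%E.
  by rewrite lee_fin; exact: nnfun_muleindic_ge0.
have mh y : measurable (h @^-1` [set y]) by exact: measurable_funPTI.
have f0' x : (0 <= (f x)%:E)%E by rewrite lee_fin.
rewrite integralT_nnsfun sintegralE.
under [RHS]eq_integral => x _.
  rewrite fimfunE -fsumEFin// ge0_mule_fsuml; last by move=> y; exact: h0.
  over.
rewrite ge0_integral_fsum//.
- apply: eq_fsbigr => y /set_mem[x _ <-].
  under eq_integral do rewrite EFinM -muleA.
  rewrite ge0_integralZl//.
  + congr (_ * _)%E; rewrite mE; last exact: mh.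
    rewrite [LHS]integral_mkcond; apply: eq_integral => z _.
    by rewrite epatch_indic muleC.
  + apply/measurable_EFinP/measurable_funM => //.
    by apply: measurable_indic; exact: mh.
  + by move=> z _; rewrite lee_fin mulr_ge0.
  + by rewrite lee_fin; exact: fun_ge0.
- move=> y; apply/measurable_EFinP/measurable_funM => //.
  apply: measurable_funM => //.
  by apply: measurable_indic; exact: mh.
- by move=> y x _; rewrite mule_ge0.
Qed.

(** Simple functions first, then monotone convergence; [m] may have infinite mass, as Lévy measures
    can. *)
Lemma ge0_integral_density (g : R -> \bar R) :
  measurable_fun setT g -> (forall x, 0 <= g x)%E ->
  (\int[m]_x g x = \int[mu]_x (g x * (f x)%:E))%E.
Proof.
move=> mg g0; pose h := nnsfun_approx measurableT mg.
have mh n : measurable_fun setT (h n) by [].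
have hnd x a b : (a <= b)%N -> h a x <= h b x.
  by move=> ab; exact/lefP/nd_nnsfun_approx.
have gE x : g x = limn (fun n => ((h n x)%:E)).
  by apply/esym/cvg_lim => //; exact: cvg_nnsfun_approx.
transitivity (limn (fun n => (\int[m]_x (h n x)%:E)%E)).
  under eq_integral do rewrite gE.
  apply: monotone_convergence => //.
  - by move=> n; apply/measurable_EFinP.
  - by move=> n x _; rewrite lee_fin.
  - by move=> x _ a b ab; rewrite lee_fin; exact: hnd.
transitivity (limn (fun n => (\int[mu]_x ((h n x)%:E * (f x)%:E))%E)).
  by apply: congr_lim; apply/funext => n; rewrite integral_nnsfun_density.
rewrite -monotone_convergence//.
- apply: eq_integral => x _; apply/cvg_lim => //.
  by apply: cvgeZr => //; exact: cvg_nnsfun_approx.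
- by move=> n; apply/measurable_EFinP/measurable_funM => //; exact: mh.
- by move=> n x _; rewrite lee_fin mulr_ge0.
- move=> x _ a b ab; rewrite lee_fin ler_wpM2r//.
  exact: hnd.
Qed.

Lemma integrable_density (g : R -> R) : m.-integrable setT (EFin \o g) ->
  mu.-integrable setT (EFin \o (fun x => g x * f x)) /\
  \int[m]_x g x = \int[mu]_x (g x * f x).
Proof.
move=> /integrableP[/measurable_EFinP mg gfin]; split.
  apply/integrableP; split; first exact/measurable_EFinP/measurable_funM.
  move: gfin; rewrite ge0_integral_density//; last first.
    by apply/measurable_EFinP; exact: measurableT_comp.
  by under eq_integral do rewrite -EFinM -{1}(ger0_norm (f0 _)) -normrM.
(* Multiplication by the nonnegative [f] commutes with taking positive and negative parts. *)
rewrite /Rintegral; congr fine; rewrite integralE [RHS]integralE.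
congr (_ - _)%E.
  rewrite ge0_integral_density//; last first.
    by apply: measurable_funepos; exact/measurable_EFinP.
  apply: eq_integral => x _.
  by rewrite !funeposE /= -!EFin_max -EFinM maxr_pMl// mul0r.
rewrite ge0_integral_density//; last first.
  by apply: measurable_funeneg; exact/measurable_EFinP.
apply: eq_integral => x _.
by rewrite !funenegE /= -!EFin_max -EFinM maxr_pMl// mul0r mulNr.
Qed.

End change_of_density.

(** Nothing is known of [psi] outside the positive half-line. Composing with [expR] gives a function
    monotone on the whole line, and [ln] brings it back. *)
Lemma measurable_decreasing_on_pos (psi : R -> R) : decreasing_on_pos psi ->
  measurable_fun (`]0, +oo[ : set R) psi.
Proof.
move=> dpsi.
have mexp : measurable_fun setT (psi \o expR).
  apply: nonincreasing_measurable => // x y xy.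
  by apply: dpsi; [exact: expR_gt0|rewrite ler_expR].
apply: (eq_measurable_fun ((psi \o expR) \o @ln R)).
  by move=> u /set_mem/=; rewrite in_itv/= andbT => u0; rewrite lnK.
by apply: measurable_funTS; apply: measurableT_comp => //; exact: measurable_ln.
Qed.

Lemma levy_densityE (psi1 psi2 : R -> R) u :
  levy_density psi1 psi2 u =
    if 0 < u then psi1 u / u else if u < 0 then psi2 (- u) / (- u) else 0.
Proof.
rewrite /levy_density !indicE !mem_setE !in_itv/= andbT.
by case: ltgtP => _; rewrite ?mulr1 ?mulr0 ?addr0 ?add0r.
Qed.

Lemma measurable_levy_density (psi1 psi2 : R -> R) :
  decreasing_on_pos psi1 -> decreasing_on_pos psi2 ->
  measurable_fun setT (levy_density psi1 psi2).
Proof.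
move=> d1 d2.
have part (psi : R -> R) : decreasing_on_pos psi ->
    measurable_fun setT ((fun u => psi u / u) \_ `]0, +oo[).
  move=> dpsi; apply/(measurable_restrictT _ _).1 => //.
  apply: measurable_funM; first exact: measurable_decreasing_on_pos.
  by apply: measurable_funTS; exact: measurable_invr.
have -> : levy_density psi1 psi2 =
    (fun u => ((fun u => psi1 u / u) \_ `]0, +oo[) u +
              ((fun u => psi2 u / u) \_ `]0, +oo[) (- u)).
  apply/funext => u; rewrite levy_densityE !patchE !mem_setE !in_itv/= !andbT oppr_gt0.
  by case: ltgtP => _; rewrite ?addr0 ?add0r.
apply: measurable_funD; first exact: part.
by apply: measurableT_comp; [exact: part|exact: oppr_measurable].
Qed.

(** If [k < 0], the measure of [[a, b]] would be at most [k * (b - a) < 0]. *)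
Lemma has_density_nonneg (m : {measure set R -> \bar R}) (f : R -> R) (a b k : R) :
  has_density m f -> a < b -> measurable_fun `[a, b] f ->
  (forall u, a <= u <= b -> f u <= k) -> 0 <= k.
Proof.
move=> mE ab mf fk; rewrite leNgt; apply/negP => k0.
have : (0 <= m `[a, b]%classic)%E by exact: measure_ge0.
rewrite mE// leNgt => /negP; apply.
have -> : (\int[mu]_(u in `[a, b]) (f u)%:E = - \int[mu]_(u in `[a, b]) (- f u)%:E)%E.
  rewrite -integral_ge0N/=.
    by apply: eq_integral => u _; rewrite opprK.
  move=> u; rewrite /= in_itv/= => /fk; rewrite lee_fin; lra.
rewrite oppe_lt0.
apply: (@lt_le_trans _ _ (\int[mu]_(u in `[a, b]) (- k)%:E)%E).
  have muab : mu `[a, b] = (b - a)%:E.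
    by rewrite lebesgue_measure_itv/= lte_fin ab -EFinB.
  rewrite integral_cst// -[X in (_ * X)%E]/(mu `[a, b]%classic) muab.
  by rewrite mule_gt0// lte_fin; lra.
apply: ge0_le_integral => //.
- by move=> u _; rewrite lee_fin; lra.
- by apply/measurable_EFinP; exact: measurable_funN.
- by move=> u; rewrite /= in_itv/= => /fk; rewrite lee_fin; lra.
Qed.

(** A density of a measure is nonnegative only almost everywhere; monotonicity gives every point. A
    negative value at [u] persists away from the origin and keeps the density below a negative
    constant on an interval of length [1]. *)
Lemma levy_density_ge0 (m : {measure set R -> \bar R}) (psi1 psi2 : R -> R) u :
  decreasing_on_pos psi1 -> decreasing_on_pos psi2 ->
  has_density m (levy_density psi1 psi2) -> 0 <= levy_density psi1 psi2 u.
Proof.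
move=> d1 d2 mE; rewrite levy_densityE.
have mld := measurable_levy_density d1 d2.
have bnd (c v x : R) : c < 0 -> 0 < v -> v <= x <= v + 1 -> c / x <= c / (v + 1).
  move=> c0 v0 /andP[vx xv]; rewrite ler_nM2l// lef_pV2 ?posrE//; lra.
have neg (c v : R) : c < 0 -> 0 < v -> c / (v + 1) < 0.
  by move=> c0 v0; rewrite nmulr_rlt0// invr_gt0; lra.
case: ltgtP => [u0|u0|//].
- rewrite divr_ge0 ?(ltW u0)// leNgt; apply/negP => p0.
  have := neg _ _ p0 u0; apply/negP; rewrite -leNgt.
  apply: (has_density_nonneg mE (a := u) (b := u + 1)); first lra.
    exact: measurable_funTS.
  move=> v /andP[uv vu]; rewrite levy_densityE ifT; last lra.
  apply: (@le_trans _ _ (psi1 u / v)).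
    by rewrite ler_pM2r ?invr_gt0 ?d1//; lra.
  by apply: bnd => //; lra.
- have nu0 : 0 < - u by lra.
  rewrite divr_ge0 ?(ltW nu0)// leNgt; apply/negP => p0.
  have := neg _ _ p0 nu0; apply/negP; rewrite -leNgt.
  apply: (has_density_nonneg mE (a := u - 1) (b := u)); first lra.
    exact: measurable_funTS.
  move=> v /andP[uv vu]; rewrite levy_densityE ifF; last first.
    by apply/negbTE; rewrite -leNgt; lra.
  rewrite ifT; last lra.
  apply: (@le_trans _ _ (psi2 (- u) / (- v))).
    by rewrite ler_pM2r ?invr_gt0 ?d2//; lra.
  by apply: bnd => //; lra.
Qed.

End density.

(** * Characteristic exponents *)

Section characteristic_exponent.
Context {R : realType}.
Local Open Scope complex_scope.

Lemma cexpE (a c : R) : cexp (a +i* c) = (expR a * cos c) +i* (expR a * sin c).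
Proof. by rewrite /cexp /=; simpc. Qed.

Lemma expiE (x : R) : expi x = cos x +i* sin x.
Proof.
rewrite /expi.
have -> : 'i * x%:C = 0 +i* x by simpc.
by rewrite cexpE expR0 !mul1r.
Qed.

Variables (d : measure_display) (T : measurableType d) (P : probability T R)
  (X : {RV P >-> R}) (b : R) (nu : {measure set R -> \bar R}).

Definition re_exponent (t : R) : R := \int[nu]_u (cos (t * u) - 1).

Definition im_exponent (t : R) : R :=
  t * b + \int[nu]_u (sin (t * u) - t * u * (`|u| <= 1)%R%:R).

Lemma levy_exponentE t :
  levy_exponent b nu t = re_exponent t +i* im_exponent t.
Proof.
rewrite /levy_exponent /Cintegral /re_exponent /im_exponent.
have E u : expi (t * u) - 1 - 'i * (t * u)%:C * (`|u| <= 1)%R%:R =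
    (cos (t * u) - 1) +i* (sin (t * u) - t * u * (`|u| <= 1)%R%:R).
  rewrite expiE; case: (`|u| <= 1)%R => /=; rewrite ?mulr1n ?mulr0n; simpc; by [].
under eq_Rintegral do rewrite E/=.
under [X in _ +i* X]eq_Rintegral do rewrite E/=.
by simpc.
Qed.

Lemma ID_cos_sin t : ID X b nu ->
  \int[P]_w cos (t * X w) = expR (re_exponent t) * cos (im_exponent t) /\
  \int[P]_w sin (t * X w) = expR (re_exponent t) * sin (im_exponent t).
Proof.
move=> [_ /(_ t)]; rewrite levy_exponentE cexpE /charfun /Cintegral.
under eq_Rintegral do rewrite expiE/=.
under [X in _ +i* X]eq_Rintegral do rewrite expiE/=.
by case.
Qed.

End characteristic_exponent.

(** * Difference of two characteristic exponents *)

Section exponent_comparison.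
Context {R : realType}.
Local Notation mu := (@lebesgue_measure R).
Implicit Types t u : R.

(** Multiplied by [1 / |u|] from the Lévy density, this weight becomes [|u|] for [|u| <= 1] and [1]
    beyond: the weights in [Delta]. *)
Definition levy_weight u : R := Num.min (u ^+ 2) `|u|.

Lemma levy_weight_ge0 u : 0 <= levy_weight u.
Proof. by rewrite /levy_weight le_min sqr_ge0 normr_ge0. Qed.

Lemma measurable_levy_weight : measurable_fun setT levy_weight.
Proof. by apply: measurable_minr; [exact: measurable_funX|exact: normr_measurable]. Qed.

Lemma levy_weight_ge (k1 k2 v u : R) : 0 <= k1 -> 0 <= k2 ->
  v <= k1 * `|u| -> v <= k2 * u ^+ 2 -> v <= (k1 + k2) * levy_weight u.
Proof.
move=> k10 k20 h1 h2; rewrite /levy_weight.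
have [_|_] := leP (u ^+ 2) `|u|; rewrite mulrDl.
  by rewrite (le_trans h2)// lerDr mulr_ge0// sqr_ge0.
by rewrite (le_trans h1)// lerDl mulr_ge0.
Qed.

Lemma cos_levy_weight t u : 0 <= t ->
  `|cos (t * u) - 1| <= (t + t ^+ 2) * levy_weight u.
Proof.
move=> t0; apply: levy_weight_ge; rewrite ?sqr_ge0//.
  by rewrite (le_trans (cos_subr1_le _))// normrM ger0_norm.
by rewrite -exprMn; exact: (cos_sin_quadratic _).1.
Qed.

Lemma sin_levy_weight t u : 0 <= t ->
  `|sin (t * u) - t * u| <= (2 * t + t ^+ 2) * levy_weight u.
Proof.
move=> t0; apply: levy_weight_ge; rewrite ?sqr_ge0 ?mulr_ge0//.
  by rewrite (le_trans (sin_subr_le_lin _))// normrM ger0_norm// mulrA.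
by rewrite -exprMn; exact: (cos_sin_quadratic _).2.
Qed.

Lemma indicator_le1E u : (`|u| <= 1)%R%:R = \1_(`[-1, 1] : set R) u :> R.
Proof. by rewrite indicE mem_setE in_itv/= ler_norml. Qed.

Lemma measurable_indicator_le1 :
  measurable_fun setT (fun u => (`|u| <= 1)%R%:R : R).
Proof.
rewrite (_ : (fun u => _) = \1_(`[-1, 1] : set R)) //.
by apply/funext => u; exact: indicator_le1E.
Qed.

(** The gap between the full and the truncated compensator: [sin (t u) - t u 1_(|u| <= 1) = t *
    big_jump u + (sin (t u) - t u)]. *)
Definition big_jump u : R := u * (1 - (`|u| <= 1)%R%:R).

Lemma measurable_big_jump : measurable_fun setT big_jump.
Proof.
apply: measurable_funM => //; apply: measurable_funB => //.
exact: measurable_indicator_le1.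
Qed.

Lemma big_jump_levy_weight u : `|big_jump u| <= levy_weight u.
Proof.
rewrite /big_jump; have [u1|u1] := leP `|u| 1.
  by rewrite /= mulr1n subrr mulr0 normr0 levy_weight_ge0.
rewrite /= mulr0n subr0 mulr1 /levy_weight le_min lexx andbT.
rewrite -real_normK ?num_real// expr2 ler_peMr// ltW//.
Qed.

Lemma measurable_cos_scale t : measurable_fun setT (fun u => cos (t * u)).
Proof. by apply: (measurableT_comp measurable_cos); exact: measurable_funM. Qed.

Lemma measurable_sin_scale t : measurable_fun setT (fun u => sin (t * u)).
Proof. by apply: (measurableT_comp measurable_sin); exact: measurable_funM. Qed.

Section integrable_exponents.
Variable nu : {measure set R -> \bar R}.
Hypothesis nuL : levy_measure nu.

Lemma integrable_levy (g : R -> R) (k : R) : measurable_fun setT g ->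
  (forall u, `|g u| <= k * Num.min 1 (u ^+ 2)) ->
  nu.-integrable setT (EFin \o g).
Proof.
move=> mg gk.
have mm : measurable_fun setT (fun u : R => Num.min 1 (u ^+ 2)).
  by apply: measurable_minr => //; exact: measurable_funX.
have : nu.-integrable setT (EFin \o (fun u => Num.min 1 (u ^+ 2))).
  apply/integrableP; split; first exact/measurable_EFinP.
  under eq_integral.
    move=> u _; rewrite /= ger0_norm; last by rewrite le_min ler01 sqr_ge0.
    over.
  by case: nuL.
move=> /(integrable_EFinZl k measurableT) im.
by apply: (le_integrable_EFin _ mg im).
Qed.

Lemma integrable_cos_exponent t :
  nu.-integrable setT (EFin \o (fun u => cos (t * u) - 1)).
Proof.
apply: (@integrable_levy _ (2 + t ^+ 2)).
  by apply: measurable_funB => //; exact: measurable_cos_scale.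
move=> u.
have h1 : `|cos (t * u) - 1| <= 2.
  by have := cos_geN1 (t * u); have := cos_le1 (t * u); rewrite ler_norml; lra.
have h2 := (cos_sin_quadratic (t * u)).1.
rewrite exprMn in h2.
have [_|_] := leP 1 (u ^+ 2); rewrite mulrDl.
  by rewrite mulr1 (le_trans h1)// lerDl mulr1 sqr_ge0.
by rewrite (le_trans h2)// lerDr mulr_ge0 ?sqr_ge0.
Qed.

Lemma integrable_sin_exponent t :
  nu.-integrable setT
    (EFin \o (fun u => sin (t * u) - t * u * (`|u| <= 1)%R%:R)).
Proof.
apply: (@integrable_levy _ (1 + t ^+ 2)).
  apply: measurable_funB; first exact: measurable_sin_scale.
  by apply: measurable_funM; [exact: measurable_funM|exact: measurable_indicator_le1].
move=> u; have [u1|u1] := leP `|u| 1.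
  rewrite /= mulr1n mulr1.
  have u2 : u ^+ 2 <= 1 by rewrite -real_normK ?num_real// expr_le1.
  rewrite min_r// mulrDl mul1r -exprMn.
  by rewrite (le_trans (cos_sin_quadratic _).2)// lerDr sqr_ge0.
rewrite /= mulr0n mulr0 subr0.
have u2 : 1 <= u ^+ 2 by rewrite -real_normK ?num_real// expr_ge1// ltW.
by rewrite min_l// mulr1 (le_trans (sin_max _))// lerDl sqr_ge0.
Qed.

Lemma re_exponent_le0 t : re_exponent nu t <= 0.
Proof.
rewrite -oppr_ge0 /re_exponent.
have -> : - (\int[nu]_u (cos (t * u) - 1)) = \int[nu]_u (- 1 * (cos (t * u) - 1)).
  by rewrite RintegralZl ?mulN1r//; exact: integrable_cos_exponent.
by apply: Rintegral_ge0 => u _; rewrite mulN1r opprB subr_ge0 cos_le1.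
Qed.

End integrable_exponents.

Section two_levy_measures.
Variables (nu1 nu2 : {measure set R -> \bar R}) (f1 f2 : R -> R) (b1 b2 : R).
Hypotheses (nuL1 : levy_measure nu1) (nuL2 : levy_measure nu2)
  (mf1 : measurable_fun setT f1) (mf2 : measurable_fun setT f2)
  (f10 : forall u, 0 <= f1 u) (f20 : forall u, 0 <= f2 u)
  (nuE1 : has_density nu1 f1) (nuE2 : has_density nu2 f2)
  (wf : mu.-integrable setT (EFin \o (fun u => levy_weight u * `|f1 u - f2 u|))).

Definition levy_distance : R := \int[mu]_u (levy_weight u * `|f1 u - f2 u|).

(** A signed quantity, formally the difference of the two means. The big jumps are integrated
    against [f1 - f2], where [wf] ensures convergence. *)
Definition drift_distance : R :=
  b1 - b2 + \int[mu]_u (big_jump u * (f1 u - f2 u)).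

(** This gives a meaning to integrals against [f1 - f2] of functions of linear growth, such as
    [sin (t u) - t u], with no recourse to [nu1] and [nu2] separately. *)
Lemma weighted_density_difference (g : R -> R) (k : R) :
  measurable_fun setT g -> (forall u, `|g u| <= k * levy_weight u) ->
  mu.-integrable setT (EFin \o (fun u => g u * (f1 u - f2 u))) /\
  `|\int[mu]_u (g u * (f1 u - f2 u))| <= k * levy_distance.
Proof.
move=> mg gk.
have mgf : measurable_fun setT (fun u => g u * (f1 u - f2 u)).
  by apply: measurable_funM => //; exact: measurable_funB.
have gkf u : `|g u * (f1 u - f2 u)| <= k * (levy_weight u * `|f1 u - f2 u|).
  by rewrite normrM mulrA ler_wpM2r.
have ikw := integrable_EFinZl k measurableT wf.
split; first by apply: (le_integrable_EFin _ _ ikw).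
rewrite /levy_distance -RintegralZl//.
by apply: normr_Rintegral_le.
Qed.

Lemma Rintegral_density_difference (g : R -> R) :
  nu1.-integrable setT (EFin \o g) -> nu2.-integrable setT (EFin \o g) ->
  \int[nu1]_u g u - \int[nu2]_u g u = \int[mu]_u (g u * (f1 u - f2 u)).
Proof.
move=> i1 i2.
have [j1 ->] := integrable_density mf1 f10 nuE1 i1.
have [j2 ->] := integrable_density mf2 f20 nuE2 i2.
rewrite -RintegralB//; apply: eq_Rintegral => u _.
by rewrite mulrBr.
Qed.

Lemma re_exponent_diff t :
  re_exponent nu1 t - re_exponent nu2 t =
  \int[mu]_u ((cos (t * u) - 1) * (f1 u - f2 u)).
Proof. by apply: Rintegral_density_difference; exact: integrable_cos_exponent. Qed.

(** The truncated compensator is kept until both integrals are merged into one against [f1 - f2].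
    Only then is it split into [t * big_jump] and the fully compensated sine, each dominated by
    [levy_weight]. *)
Lemma im_exponent_diff t : 0 <= t ->
  im_exponent b1 nu1 t - im_exponent b2 nu2 t =
  t * drift_distance + \int[mu]_u ((sin (t * u) - t * u) * (f1 u - f2 u)).
Proof.
move=> t0; rewrite /im_exponent /drift_distance.
set i1 := \int[nu1]_u _; set i2 := \int[nu2]_u _.
have -> : t * b1 + i1 - (t * b2 + i2) = t * (b1 - b2) + (i1 - i2) by ring.
rewrite /i1 /i2 Rintegral_density_difference; [|exact: integrable_sin_exponent..].
have [i3 _] := @weighted_density_difference big_jump 1 measurable_big_jump
  (fun u => ltac:(rewrite mul1r; exact: big_jump_levy_weight)).
have ms : measurable_fun setT (fun u => sin (t * u) - t * u).
  by apply: measurable_funB; [exact: measurable_sin_scale|exact: measurable_funM].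
have [i4 _] := weighted_density_difference ms (fun u => sin_levy_weight u t0).
rewrite [in RHS]mulrDr -[in RHS]addrA; congr (_ + _).
rewrite -RintegralZl// -RintegralD//; last exact: integrable_EFinZl.
by apply: eq_Rintegral => u _; rewrite /big_jump; ring.
Qed.

Lemma re_exponent_dist t : 0 <= t ->
  `|re_exponent nu1 t - re_exponent nu2 t| <= (t + t ^+ 2) * levy_distance.
Proof.
move=> t0; rewrite re_exponent_diff.
apply: (weighted_density_difference _ (fun u => cos_levy_weight u t0)).2.
by apply: measurable_funB => //; exact: measurable_cos_scale.
Qed.

Lemma im_exponent_dist t : 0 <= t ->
  `|im_exponent b1 nu1 t - im_exponent b2 nu2 t| <=
  t * `|drift_distance| + (2 * t + t ^+ 2) * levy_distance.
Proof.
move=> t0; rewrite im_exponent_diff// (le_trans (ler_normD _ _))//.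
rewrite normrM (ger0_norm t0) lerD2l.
apply: (weighted_density_difference _ (fun u => sin_levy_weight u t0)).2.
by apply: measurable_funB; [exact: measurable_sin_scale|exact: measurable_funM].
Qed.

Lemma levy_distance_ge0 : 0 <= levy_distance.
Proof. by apply: Rintegral_ge0 => u _; rewrite mulr_ge0 ?levy_weight_ge0. Qed.

End two_levy_measures.
End exponent_comparison.

(** * The drift difference is the difference of the means *)

Section mean_and_drift.
Context {R : realType}.
Local Notation mu := (@lebesgue_measure R).

(** The limit [t -> 0] is taken along [harmonic n = 1 / (n + 1)], so that dominated convergence for
    sequences applies. *)
Lemma cvg_of_dist_harmonic (u : R^nat) (l k : R) :
  (forall n, `|u n - l| <= k * harmonic n) -> u @ \oo --> l.
Proof.
move=> h; apply/subr_cvg0; apply: norm_cvg0.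
have : k * harmonic n @[n --> \oo] --> (0 : R).
  rewrite -[X in _ --> X](mulr0 k); apply: cvgMr; exact: cvg_harmonic.
apply: squeeze_cvgr (cvg_cst _) => //.
by near=> n; rewrite normr_ge0/= h.
Unshelve. all: end_near. Qed.

Lemma Rintegral_dominated_cvg d (T : measurableType d)
    (m : {measure set T -> \bar R}) (f_ : nat -> T -> R) (f g : T -> R) :
  (forall n, measurable_fun setT (f_ n)) -> measurable_fun setT f ->
  m.-integrable setT (EFin \o g) -> (forall n x, `|f_ n x| <= g x) ->
  (forall x, f_ n x @[n --> \oo] --> f x) ->
  \int[m]_x f_ n x @[n --> \oo] --> \int[m]_x f x.
Proof.
move=> mf_ mf ig fg ff.
have cf : {ae m, forall x, setT x -> (f_ n x)%:E @[n --> \oo] --> (f x)%:E}.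
  by apply: aeW => x _; apply: cvg_EFin; [exact: nearW|exact: ff].
have bf : {ae m, forall x n, setT x -> (`|(f_ n x)%:E| <= (EFin \o g) x)%E}.
  by apply: aeW => x n _; rewrite lee_fin.
have mEf_ n : measurable_fun setT (fun x => (f_ n x)%:E) by exact/measurable_EFinP.
have mEf : measurable_fun setT (EFin \o f) by exact/measurable_EFinP.
have [intf _ cvgf] := dominated_convergence measurableT mEf_ mEf cf ig bf.
by apply: fine_cvg; rewrite fineK//; exact: integrable_fin_num.
Qed.

Lemma harmonic_le1 n : harmonic n <= 1 :> R.
Proof. by rewrite /harmonic/= invf_le1// ler1n. Qed.

(** The mean is the derivative at [0] of the imaginary part of the characteristic function. The
    difference quotients are dominated by [|X|]. *)
Lemma cvg_Rintegral_sin d (T : measurableType d) (P : probability T R)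
    (X : T -> R) : P.-integrable setT (EFin \o X) ->
  (\int[P]_w sin (harmonic n * X w)) / harmonic n @[n --> \oo] --> \int[P]_w X w.
Proof.
move=> iX.
have mX : measurable_fun setT X by apply/measurable_EFinP; exact: measurable_int iX.
have ms n : measurable_fun setT (fun w => sin (harmonic n * X w)).
  by apply: (measurableT_comp measurable_sin); exact: measurable_funM.
have h0 n : 0 < harmonic n :> R by exact: harmonic_gt0.
rewrite (_ : (fun n => _) =
    (fun n => \int[P]_w (sin (harmonic n * X w) / harmonic n))); last first.
  apply/funext => n; rewrite RintegralZr//.
  apply: (@bounded_integrable _ _ _ _ _ 1) => // w; exact: sin_max.
apply: (@Rintegral_dominated_cvg _ _ _ _ _ (fun w => `|X w|)) => //.
- by move=> n; exact: measurable_funM.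
- exact: integrable_norm.
- move=> n w; rewrite normrM normfV (gtr0_norm (h0 n)) ler_pdivrMr//.
  by rewrite (le_trans (normr_sin_le _))// normrM (gtr0_norm (h0 n)) mulrC.
move=> w; apply: (@cvg_of_dist_harmonic _ _ (X w ^+ 2)) => n.
have -> : sin (harmonic n * X w) / harmonic n - X w =
    (sin (harmonic n * X w) - harmonic n * X w) / harmonic n.
  by field; rewrite gt_eqF.
rewrite normrM normfV (gtr0_norm (h0 n)) ler_pdivrMr//.
rewrite (le_trans (cos_sin_quadratic _).2)// exprMn mulrC.
by rewrite [harmonic n ^+ 2]expr2 mulrA.
Qed.

Lemma cvg_Rintegral_cos d (T : measurableType d) (P : probability T R)
    (X : T -> R) : P.-integrable setT (EFin \o X) ->
  \int[P]_w cos (harmonic n * X w) @[n --> \oo] --> (1 : R).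
Proof.
move=> iX.
have mX : measurable_fun setT X by apply/measurable_EFinP; exact: measurable_int iX.
have -> : 1 = \int[P]_w (cst 1 w : R).
  by rewrite Rintegral_cst//= probability_setT mulr1.
apply: (@Rintegral_dominated_cvg _ _ _ _ _ (cst 1)) => //.
- by move=> n; apply: (measurableT_comp measurable_cos); exact: measurable_funM.
- exact: finite_measure_integrable_cst.
- by move=> n w; exact: cos_max.
move=> w; apply: (@cvg_of_dist_harmonic _ _ `|X w|) => n.
by rewrite (le_trans (cos_subr1_le _))// normrM ger0_norm ?harmonic_ge0// mulrC.
Qed.

Variables (d1 : measure_display) (T1 : measurableType d1) (P1 : probability T1 R)
  (d2 : measure_display) (T2 : measurableType d2) (P2 : probability T2 R)
  (X1 : {RV P1 >-> R}) (X2 : {RV P2 >-> R})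
  (nu1 nu2 : {measure set R -> \bar R}) (f1 f2 : R -> R) (b1 b2 : R).
Hypotheses (iX1 : P1.-integrable setT (EFin \o X1))
  (iX2 : P2.-integrable setT (EFin \o X2))
  (ID1 : ID X1 b1 nu1) (ID2 : ID X2 b2 nu2)
  (mf1 : measurable_fun setT f1) (mf2 : measurable_fun setT f2)
  (f10 : forall u, 0 <= f1 u) (f20 : forall u, 0 <= f2 u)
  (nuE1 : has_density nu1 f1) (nuE2 : has_density nu2 f2)
  (wf : mu.-integrable setT (EFin \o (fun u => levy_weight u * `|f1 u - f2 u|))).

(** The quotient of the two characteristic functions at [h n] is [e^(r n + i j n)], where [r n -> 0]
    and [j n / h n -> beta]. Comparing the first-order terms gives [E X1 = E X2 + beta]. *)
Lemma drift_distanceE :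
  drift_distance f1 f2 b1 b2 = \int[P1]_w X1 w - \int[P2]_w X2 w.
Proof.
pose beta := drift_distance f1 f2 b1 b2.
pose h n : R := harmonic n.
pose r n := re_exponent nu1 (h n) - re_exponent nu2 (h n).
pose j n := im_exponent b1 nu1 (h n) - im_exponent b2 nu2 (h n).
pose I0 := levy_distance f1 f2.
have I00 : 0 <= I0 by exact: levy_distance_ge0.
have h0 n : 0 < h n by exact: harmonic_gt0.
have h1 n : h n <= 1 by exact: harmonic_le1.
have [L1 _] := ID1; have [L2 _] := ID2.
have hh n : h n ^+ 2 <= h n by rewrite expr2 ler_piMr// ltW.
have ms n : measurable_fun setT (fun u => sin (h n * u) - h n * u).
  by apply: measurable_funB; [exact: measurable_sin_scale|exact: measurable_funM].
(* As [h n <= 1], squares of [h n] are absorbed into [h n], whence the constants [2 = 1 + 1] here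
   and [3 = 2 + 1] below. *)
have rle n : `|r n| <= 2 * I0 * h n.
  apply: (le_trans (re_exponent_dist L1 L2 mf1 mf2 f10 f20 nuE1 nuE2 wf (ltW (h0 n)))).
  by rewrite -/I0; have := hh n; nra.
have jle n : `|j n| <= (`|beta| + 3 * I0) * h n.
  apply: (le_trans (im_exponent_dist b1 b2 L1 L2 mf1 mf2 f10 f20 nuE1 nuE2 wf (ltW (h0 n)))).
  by rewrite -/I0 -/beta; have := hh n; nra.
have r_cvg : r @ \oo --> (0 : R).
  by apply: (@cvg_of_dist_harmonic _ _ (2 * I0)) => n; rewrite subr0.
have j_cvg : j @ \oo --> (0 : R).
  by apply: (@cvg_of_dist_harmonic _ _ (`|beta| + 3 * I0)) => n; rewrite subr0.
have jh_cvg : j n / h n @[n --> \oo] --> beta.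
  have -> : (fun n => j n / h n) = (fun n => beta +
      \int[mu]_u ((sin (h n * u) - h n * u) / h n * (f1 u - f2 u))).
    apply/funext => n; rewrite /j (im_exponent_diff b1 b2 L1 L2 mf1 mf2 f10 f20 nuE1 nuE2 wf (ltW (h0 n))).
    have [i4 _] := weighted_density_difference mf1 mf2 wf (ms n)
      (fun u => sin_levy_weight u (ltW (h0 n))).
    rewrite mulrDl mulrAC divff ?gt_eqF// mul1r -RintegralZr// -/beta; congr (_ + _).
    by apply: eq_Rintegral => u _; rewrite mulrAC.
  rewrite -[X in _ --> X]addr0; apply: cvgD; first exact: cvg_cst.
  (* Dominated convergence against [f1 - f2]: the integrand is at most [3] times the weighted
     difference and is pointwise [O(h n)]. *)
  have -> : 0 = \int[mu]_u (cst 0 u : R).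
    by rewrite /Rintegral integral0.
  have i3 := integrable_EFinZl 3 measurableT wf.
  apply: (Rintegral_dominated_cvg _ _ i3).
  - move=> n; apply: measurable_funM; last exact: measurable_funB.
    by apply: measurable_funM => //; exact: ms.
  - exact: measurable_cst.
  - move=> n u; rewrite normrM mulrA ler_wpM2r//.
    rewrite normrM normfV (gtr0_norm (h0 n)) ler_pdivrMr//.
    apply: (le_trans (sin_levy_weight u (ltW (h0 n)))).
    rewrite mulrAC ler_wpM2r ?levy_weight_ge0//.
    by have := hh n; lra.
  move=> u; apply: (@cvg_of_dist_harmonic _ _ (u ^+ 2 * `|f1 u - f2 u|)) => n.
  rewrite subr0 normrM mulrAC ler_wpM2r//.
  rewrite normrM normfV (gtr0_norm (h0 n)) ler_pdivrMr//.
  by rewrite (le_trans (cos_sin_quadratic _).2)// exprMn mulrC [h n ^+ 2]expr2 mulrA.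
have sinj_cvg : sin (j n) / h n @[n --> \oo] --> beta.
  have -> : (fun n => sin (j n) / h n) =
      (fun n => j n / h n + (sin (j n) - j n) / h n).
    by apply/funext => n; rewrite -mulrDl addrC subrK.
  rewrite -[X in _ --> X]addr0; apply: cvgD => //.
  (* Here [|sin j - j| <= j^2] is of order [h^2], so it remains [O(h)] after division by [h]. *)
  apply: (@cvg_of_dist_harmonic _ _ ((`|beta| + 3 * I0) ^+ 2)) => n.
  rewrite subr0 normrM normfV (gtr0_norm (h0 n)) ler_pdivrMr//.
  rewrite (le_trans (cos_sin_quadratic _).2)//.
  have -> : (`|beta| + 3 * I0) ^+ 2 * harmonic n * h n = ((`|beta| + 3 * I0) * h n) ^+ 2.
    by rewrite /h; ring.
  by rewrite -real_normK ?num_real// lerXn2r ?nnegrE// mulr_ge0 ?addr_ge0 ?mulr_ge0// ltW.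
have lim1 := cvg_Rintegral_sin iX1.
have lim2 : (\int[P1]_w sin (harmonic n * X1 w)) / harmonic n @[n --> \oo] -->
    expR 0 * (\int[P2]_w X2 w * cos 0 + 1 * beta).
  (* The imaginary part of the characteristic function of [X2] at [h n] times [e^(r n + i j n)],
     divided by [h n]. *)
  have -> : (fun n => (\int[P1]_w sin (harmonic n * X1 w)) / harmonic n) =
      (fun n => expR (r n) * ((\int[P2]_w sin (h n * X2 w)) / h n * cos (j n) +
        \int[P2]_w cos (h n * X2 w) * (sin (j n) / h n))).
    apply/funext => n; rewrite -/(h n).
    have [_ ->] := ID_cos_sin (h n) ID1; have [-> ->] := ID_cos_sin (h n) ID2.
    have -> : re_exponent nu1 (h n) = r n + re_exponent nu2 (h n) by rewrite subrK.
    have -> : im_exponent b1 nu1 (h n) = im_exponent b2 nu2 (h n) + j n.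
      by rewrite addrC subrK.
    by rewrite expRD sinD; field; rewrite gt_eqF.
  apply: cvgM; first by apply: continuous_cvg => //; exact: continuous_expR.
  apply: cvgD; apply: cvgM => //.
  - exact: cvg_Rintegral_sin.
  - by apply: continuous_cvg => //; exact: continuous_cos.
  - exact: cvg_Rintegral_cos.
have -> := cvg_unique (@norm_hausdorff _ _) lim1 lim2.
by rewrite expR0 cos0 !mul1r mulr1 -/beta; ring.
Qed.

(** Centring at [x] subtracts the same [t * x] from both imaginary exponents, so the bound is
    uniform in [x]. The real part contributes [t + t^2] and the imaginary part [2 t + t^2], which
    add up to [3 t + 2 t^2]. *)
Lemma Rintegral_sin_dist t x : 0 <= t ->
  `|\int[P1]_w sin (t * (X1 w - x)) - \int[P2]_w sin (t * (X2 w - x))| <=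
  (`|\int[P1]_w X1 w - \int[P2]_w X2 w| + levy_distance f1 f2) *
    (3 * t + 2 * t ^+ 2).
Proof.
move=> t0.
have E d (T : measurableType d) (P : probability T R) (X : {RV P >-> R}) b nu :
    ID X b nu -> \int[P]_w sin (t * (X w - x)) =
      expR (re_exponent nu t) * sin (im_exponent b nu t - t * x).
  move=> IDX; have [cE sE] := ID_cos_sin t IDX.
  have mX : measurable_fun setT X by [].
  have ms : P.-integrable setT (EFin \o (fun w => sin (t * X w))).
    apply: (@bounded_integrable _ _ _ _ _ 1); last by move=> w; exact: sin_max.
    exact: (measurableT_comp (measurable_sin_scale t)).
  have mc : P.-integrable setT (EFin \o (fun w => cos (t * X w))).
    apply: (@bounded_integrable _ _ _ _ _ 1); last by move=> w; exact: cos_max.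
    exact: (measurableT_comp (measurable_cos_scale t)).
  transitivity (\int[P]_w (cos (t * x) * sin (t * X w) - sin (t * x) * cos (t * X w))).
    by apply: eq_Rintegral => w _; rewrite mulrBr sinB; ring.
  rewrite RintegralB//; [|exact: integrable_EFinZl..].
  by rewrite !RintegralZl// cE sE sinB; ring.
rewrite (E _ _ _ _ _ _ ID1) (E _ _ _ _ _ _ ID2).
have [L1 _] := ID1; have [L2 _] := ID2.
set a1 := re_exponent nu1 t; set a2 := re_exponent nu2 t.
set c1 := im_exponent b1 nu1 t; set c2 := im_exponent b2 nu2 t.
have ha : `|a1 - a2| <= _ :=
  re_exponent_dist L1 L2 mf1 mf2 f10 f20 nuE1 nuE2 wf t0.
have hc : `|c1 - c2| <= _ :=
  im_exponent_dist b1 b2 L1 L2 mf1 mf2 f10 f20 nuE1 nuE2 wf t0.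
rewrite -drift_distanceE.
(* One factor is changed at a time; [a1] and [a2] are nonpositive, so [expR] is [1]-Lipschitz on
   them and at most [1]. *)
have -> : expR a1 * sin (c1 - t * x) - expR a2 * sin (c2 - t * x) =
    (expR a1 - expR a2) * sin (c1 - t * x) +
    expR a2 * (sin (c1 - t * x) - sin (c2 - t * x)) by ring.
apply: (@le_trans _ _ (`|a1 - a2| + `|c1 - c2|)).
  rewrite (le_trans (ler_normD _ _))// !normrM lerD//.
    rewrite -[leRHS]mulr1 ler_pM ?sin_max//.
    by apply: dist_expR_le; exact: re_exponent_le0.
  rewrite -[leRHS]mul1r ler_pM//.
    rewrite ger0_norm ?expR_ge0// -expR0 ler_expR; exact: re_exponent_le0.
  apply: (le_trans (dist_sin_le _ _)).
  by rewrite opprB addrA subrK.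
have I0 := levy_distance_ge0 f1 f2.
have t2 := sqr_ge0 t.
apply: (le_trans (lerD ha hc)).
have h1 : 0 <= `|drift_distance f1 f2 b1 b2| * t by rewrite mulr_ge0.
have h2 : 0 <= `|drift_distance f1 f2 b1 b2| * t ^+ 2 by rewrite mulr_ge0.
by lra.
Qed.

End mean_and_drift.

(** * The Kolmogorov distance *)

Section Delta_split.
Context {R : realType}.
Local Notation mu := (@lebesgue_measure R).

Lemma measurable_reflected (psi : R -> R) : decreasing_on_pos psi ->
  measurable_fun (`]-oo, 0[ : set R) (fun u => psi (- u)).
Proof.
move=> dpsi; apply: (eq_measurable_fun ((psi \_ `]0, +oo[) \o -%R)).
  move=> u /set_mem/=; rewrite in_itv/= => u0.
  by rewrite patchE mem_setE in_itv/= andbT oppr_gt0 u0.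
apply: measurable_funTS; apply: measurableT_comp; last exact: oppr_measurable.
by apply/(measurable_restrictT _ _).1 => //; exact: measurable_decreasing_on_pos.
Qed.

(** An identity of extended reals between integrals of nonnegative functions, so it also covers an
    infinite [Delta]. *)
Lemma integral_levy_weight (psi1 psi2 psi1' psi2' : R -> R) :
  decreasing_on_pos psi1 -> decreasing_on_pos psi2 ->
  decreasing_on_pos psi1' -> decreasing_on_pos psi2' ->
  (\int[mu]_u (levy_weight u *
      `|levy_density psi1 psi2 u - levy_density psi1' psi2' u|)%:E =
   \int[mu]_(u in `]0%R, 1%R[) (`|u| * `|psi1 u - psi1' u|)%R%:E
   + \int[mu]_(u in `]1%R, +oo[) (`|psi1 u - psi1' u|)%R%:E
   + \int[mu]_(u in `](-1)%R, 0%R[)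
       (`|u| * `|psi2 (- u) - psi2' (- u)|)%R%:E
   + \int[mu]_(u in `]-oo, (-1)%R[)
       (`|psi2 (- u) - psi2' (- u)|)%R%:E)%E.
Proof.
move=> d1 d2 d1' d2'.
pose g1 u : R := `|u| * `|psi1 u - psi1' u|.
pose g2 u : R := `|psi1 u - psi1' u|.
pose g3 u : R := `|u| * `|psi2 (- u) - psi2' (- u)|.
pose g4 u : R := `|psi2 (- u) - psi2' (- u)|.
have m2 : measurable_fun (`]0, +oo[ : set R) g2.
  by apply: measurableT_comp => //; apply: measurable_funB; exact: measurable_decreasing_on_pos.
have m1 : measurable_fun (`]0, +oo[ : set R) g1.
  by apply: measurable_funM => //; apply: measurable_funTS; exact: normr_measurable.
have m4 : measurable_fun (`]-oo, 0[ : set R) g4.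
  by apply: measurableT_comp => //; apply: measurable_funB; exact: measurable_reflected.
have m3 : measurable_fun (`]-oo, 0[ : set R) g3.
  by apply: measurable_funM => //; apply: measurable_funTS; exact: normr_measurable.
have g10 u : 0 <= g1 u by rewrite mulr_ge0.
have g20 u : 0 <= g2 u by rewrite normr_ge0.
have g30 u : 0 <= g3 u by rewrite mulr_ge0.
have g40 u : 0 <= g4 u by rewrite normr_ge0.
have m1' : measurable_fun (`]0, 1] : set R) g1.
  by apply: measurable_funS m1 => //; exact: subset_itvl.
have m2' : measurable_fun (`]1, +oo[ : set R) g2.
  by apply: measurable_funS m2 => //; apply: subset_itvr; rewrite bnd_simp.
have m3' : measurable_fun (`[-1, 0[ : set R) g3.
  by apply: measurable_funS m3 => //; exact: subset_itvr.
have m4' : measurable_fun (`]-oo, -1[ : set R) g4.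
  by apply: measurable_funS m4 => //; apply: subset_itvl; rewrite bnd_simp; lra.
(* The endpoints [1] and [-1] are put in the inner intervals so that the four pieces partition the
   line without [0], where the weight vanishes. They are removed at the end as null sets. *)
transitivity (\int[mu]_u (((g1 \_ `]0, 1]) u)%:E + ((g2 \_ `]1, +oo[) u)%:E +
   ((g3 \_ `[-1, 0[) u)%:E + ((g4 \_ `]-oo, -1[) u)%:E))%E.
  apply: eq_integral => u _; rewrite -!EFinD; congr EFin.
  rewrite !levy_densityE !patchE !mem_setE !in_itv/= andbT /levy_weight.
  rewrite (_ : point = 0 :> R)//.
  have [u0|u0|<-] := ltgtP 0 u.
  - rewrite andbF (_ : (u < -1) = false); last by apply/negbTE; rewrite -leNgt; lra.
    rewrite !addr0.
    have u1 : `|u| = u by rewrite gtr0_norm.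
    have -> : `|psi1 u / u - psi1' u / u| = g2 u / u.
      by rewrite -mulrBl normrM normfV u1.
    have [u2|u2] := leP u 1.
      rewrite /= addr0 min_l; last by rewrite u1 expr2 ler_piMr// ltW.
      by rewrite /g1 -/(g2 u) u1; field; rewrite gt_eqF.
    rewrite /= add0r min_r; last by rewrite u1 expr2 ler_peMr// ltW.
    by rewrite u1; field; rewrite gt_eqF.
  - rewrite (_ : (1 < u) = false); last by apply/negbTE; rewrite -leNgt; lra.
    rewrite !add0r andbT.
    have u1 : `|u| = - u by rewrite ltr0_norm.
    have -> : `|psi2 (- u) / - u - psi2' (- u) / - u| = g4 u / - u.
      by rewrite -mulrBl normrM normfV normrN u1.
    have u2 : u ^+ 2 = (- u) * (- u) by ring.
    have [u3|u3] := leP (-1) u.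
      rewrite addr0 min_l; last by rewrite u1 u2 ler_piMr//; lra.
      by rewrite /g3 -/(g4 u) u1; field; rewrite lt_eqF.
    rewrite add0r min_r; last by rewrite u1 u2 ler_peMr//; lra.
    by rewrite u1; field; rewrite lt_eqF.
  - by rewrite andbF ltr10 ltr0N1 !addr0/= subrr normr0 mulr0.
have P0 (g : R -> R) (A : set R) u : (forall v, 0 <= g v) ->
    (0 <= ((g \_ A) u)%:E)%E.
  by move=> g0; rewrite lee_fin patchE; case: ifP.
have Pm (g : R -> R) (A : set R) : measurable A -> measurable_fun A g ->
    measurable_fun setT (fun u => ((g \_ A) u)%:E).
  by move=> mA mg; apply/measurable_EFinP/(measurable_restrictT _ _).1.
have PE (g : R -> R) (A : set R) :
    (\int[mu]_u ((g \_ A) u)%:E = \int[mu]_(u in A) (g u)%:E)%E.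
  by rewrite [RHS]integral_mkcond/=; under [RHS]eq_integral do rewrite restrict_EFin.
rewrite ge0_integralD//; last 4 first.
- by move=> u _; rewrite !adde_ge0 ?P0.
- by apply: emeasurable_funD; [apply: emeasurable_funD|]; exact: Pm.
- by move=> u _; exact: P0.
- exact: Pm.
rewrite ge0_integralD//; last 4 first.
- by move=> u _; rewrite !adde_ge0 ?P0.
- by apply: emeasurable_funD; exact: Pm.
- by move=> u _; exact: P0.
- exact: Pm.
rewrite ge0_integralD//; last 4 first.
- by move=> u _; exact: P0.
- exact: Pm.
- by move=> u _; exact: P0.
- exact: Pm.
rewrite !PE; congr (_ + _ + _ + _)%E.
- rewrite -integral_itv_bndo_bndc//; apply/measurable_EFinP.
  by apply: measurable_funS m1 => //; exact: subset_itvl.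
- rewrite -integral_itv_obnd_cbnd//; apply/measurable_EFinP.
  by apply: measurable_funS m3 => //; exact: subset_itvr.
Qed.

End Delta_split.

(** * Choice of the bandwidth and conclusion *)

Section final_bound.
Context {R : realType}.
Local Notation mu := (@lebesgue_measure R).

Lemma has_bounded_density_lip (m : probability R R) : has_bounded_density m ->
  exists2 M : R, 0 <= M &
    forall x s : R, 0 <= s -> (m `]x, (x + s)%R]%classic <= (M * s)%:E)%E.
Proof.
move=> [f [mf f0 [M fM] fE]]; have M0 : 0 <= M := le_trans (f0 0) (fM 0).
exists M => // x s s0; rewrite fE//.
apply: (@le_trans _ _ (\int[mu]_(u in `]x, (x + s)%R]) M%:E)%E).
  apply: ge0_le_integral => //.
  - by move=> u _; rewrite lee_fin.
  - by apply/measurable_EFinP/measurable_funTS.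
  - by move=> u _; rewrite lee_fin.
have mus : mu `]x, (x + s)%R] = s%:E.
  rewrite lebesgue_measure_itv/= lte_fin ltrDl.
  move: s0; rewrite le_eqVlt => /predU1P[<-|->]; first by rewrite ltxx.
  by rewrite -EFinB addrC addKr.
by rewrite integral_cst// -[X in (_ * X)%E]/(mu `]x, (x + s)%R]%classic) mus.
Qed.

Lemma ccdfB d (T : measurableType d) (P : probability T R) (X : {RV P >-> R})
    (x s : R) : 0 <= s ->
  fine (ccdf X x) - fine (ccdf X (x + s)) = fine (distribution P X `]x, (x + s)%R]%classic).
Proof.
move=> s0.
have -> : ccdf X x = (distribution P X `]x, (x + s)%R]%classic + ccdf X (x + s))%E.
  rewrite /ccdf -measureU//.
    congr distribution; apply/seteqP; split => y /=; rewrite !in_itv/= !andbT.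
      by move=> xy; have [ys|ys] := leP y (x + s); [left; rewrite xy|right].
    by move=> [/andP[]//|]; apply: le_lt_trans; rewrite lerDl.
  apply/seteqP; split => y //= []; rewrite !in_itv/= andbT => /andP[_ ys].
  by rewrite ltNge ys.
by rewrite fineD ?fin_num_measure// addrK.
Qed.

Lemma dK_le d (T : measurableType d) (P : probability T R)
    d' (T' : measurableType d') (P' : probability T' R)
    (X : {RV P >-> R}) (Y : {RV P' >-> R}) (c : R) :
  (forall x, `|fine (ccdf X x) - fine (ccdf Y x)| <= c) -> (dK X Y <= c%:E)%E.
Proof.
move=> h; apply: ge_ereal_sup => _ [x _ <-].
have fX : cdf X x \is a fin_num by rewrite fin_num_measure.
have fY : cdf Y x \is a fin_num by rewrite fin_num_measure.
rewrite -(fineK fX) -(fineK fY) -EFinB abse_EFin lee_fin.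
have E d0 (T0 : measurableType d0) (P0 : probability T0 R) (Z : {RV P0 >-> R}) :
    fine (cdf Z x) = 1 - fine (ccdf Z x).
  by rewrite cdf_1_ccdf fineB ?fin_num_measure.
rewrite !E; have := h x; rewrite distrC; congr (`| _ | <= c).
ring.
Qed.

(** The second bound says [D <= delta^3 = D^(3/(p+2))], which holds because [D <= 1] and
    [3 <= p + 2]. *)
Lemma powR_bandwidth (D p : R) : 1 <= p -> 0 < D <= 1 ->
  let delta := D `^ (p + 2)^-1 in
  [/\ 0 < delta <= 1 & D / delta ^+ 2 <= delta].
Proof.
move=> p1 /andP[D0 D1] delta.
have q0 : 0 < (p + 2)^-1 by rewrite invr_gt0; lra.
have d0 : 0 < delta by rewrite powR_gt0.
split.
  rewrite d0 /delta -[leRHS](powRr0 D).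
  by apply: ger_powR; [rewrite D0 D1|exact: ltW].
rewrite ler_pdivrMr ?exprn_gt0// -exprS -powR_mulrn ?(ltW d0)// /delta -powRrM.
rewrite -[leLHS]powRr1 ?(ltW D0)//.
apply: ger_powR; first by rewrite D0 D1.
by rewrite mulrC ler_pdivrMr; lra.
Qed.

(* The choice [delta = D `^ (p + 2)^-1] balances the two terms for [p = 1], and is
   still admissible for [p > 1]. *)
Lemma dK_le_powR d (T : measurableType d) (P : probability T R)
    d' (T' : measurableType d') (P' : probability T' R)
    (X : {RV P >-> R}) (Y : {RV P' >-> R}) (D K M p : R) :
  0 <= D -> 0 <= K -> 0 <= M -> 1 <= p ->
  (forall delta, 0 < delta <= 1 -> forall x,
    `|fine (ccdf X x) - fine (ccdf Y x)| <= K * (D / delta ^+ 2 + M * delta)) ->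
  (dK X Y <= ((1 + K * (1 + M)) * D `^ (p + 2)^-1)%:E)%E.
Proof.
move=> D0 K0 M0 p1 h; apply: dK_le => x.
have KM : 0 <= K * (1 + M) by rewrite mulr_ge0//; lra.
(* For [D >= 1] the distance is at most [1], hence at most the power of [D]; this case accounts for
   the summand [1] in the constant. *)
have [D1|D1] := leP 1 D.
  have g01 d0 (T0 : measurableType d0) (P0 : probability T0 R) (Z : {RV P0 >-> R}) :
      0 <= fine (ccdf Z x) <= 1.
    rewrite fine_ge0/= ?measure_ge0// -lee_fin fineK ?fin_num_measure//.
    exact: probability_le1.
  apply: (@le_trans _ _ 1).
    by have := g01 _ _ _ X; have := g01 _ _ _ Y; rewrite ler_norml; lra.
  have : 1 <= D `^ (p + 2)^-1.
    rewrite -[leLHS](powRr0 D); apply: ler_powR => //.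
    by rewrite invr_ge0; lra.
  by nra.
move: D0; rewrite le_eqVlt => /predU1P[D0|D0].
  rewrite -D0 powR0 ?invr_neq0 ?gt_eqF//; last lra.
  rewrite mulr0; apply/ler_addgt0Pr => e e0; rewrite add0r.
  have KM1 : 0 < K * M + 1 by rewrite ltr_wpDl// mulr_ge0.
  (* For [D = 0] every [delta] in []0, 1]] is allowed, and letting it tend to [0] shows that the
     distance vanishes. The [+ 1] keeps the denominator positive when [K * M = 0]. *)
  pose delta := Num.min 1 (e / (K * M + 1)).
  have delta0 : 0 < delta by rewrite lt_min ltr01 divr_gt0.
  have := h delta; rewrite delta0 ge_min lexx => /(_ isT x).
  move=> /le_trans; apply; rewrite -D0 mul0r add0r mulrA.
  apply: (@le_trans _ _ ((K * M + 1) * (e / (K * M + 1)))).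
    apply: ler_pM; rewrite ?mulr_ge0 ?(ltW delta0) ?lerDl//.
    by rewrite ge_min lexx orbT.
  by rewrite mulrC divfK// gt_eqF.
have [d01 Dd] := powR_bandwidth p1 (ltac:(by rewrite D0 ltW) : 0 < D <= 1).
apply: (le_trans (h _ d01 x)); move: d01 Dd.
set delta := D `^ _ => /andP[d0 _] Dd.
have : K * (D / delta ^+ 2) <= K * delta by rewrite ler_wpM2l.
by lra.
Qed.

End final_bound.

Lemma finite_mean_integrable (R : realType) d (T : measurableType d)
    (P : probability T R) (X : {RV P >-> R}) :
  finite_mean X -> P.-integrable setT (EFin \o X).
Proof.
rewrite /finite_mean unlock => EX; apply/integrableP; split => //.
exact/measurable_EFinP.
Qed.

(** The bound for a single pair of laws. The constant depends on [X2] only through the Lipschitz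
    constant [M] of its tail function, which makes it uniform along a sequence. *)
Lemma dK_le_Delta (R : realType) d1 (T1 : measurableType d1)
    (P1 : probability T1 R) d2 (T2 : measurableType d2) (P2 : probability T2 R)
    (X1 : {RV P1 >-> R}) (X2 : {RV P2 >-> R}) (b1 b2 : R)
    (nu1 nu2 : {measure set R -> \bar R}) (psi1 psi1' psi2 psi2' : R -> R)
    (M p : R) :
  1 <= p -> 0 <= M ->
  ID X1 b1 nu1 -> ID X2 b2 nu2 -> finite_mean X1 -> finite_mean X2 ->
  decreasing_on_pos psi1 -> decreasing_on_pos psi1' ->
  decreasing_on_pos psi2 -> decreasing_on_pos psi2' ->
  has_density nu1 (levy_density psi1 psi1') ->
  has_density nu2 (levy_density psi2 psi2') ->
  (forall x s, 0 <= s -> fine (ccdf X2 x) - fine (ccdf X2 (x + s)) <= M * s) ->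
  (dK X1 X2 <= (1 + smoothing_constant * (1 + M))%:E *
     Delta X1 X2 psi1 psi1' psi2 psi2' `^ (p + 2)^-1)%E.
Proof.
move=> p1 M0 ID1 ID2 m1 m2 d1p d1n d2p d2n E1 E2 lip.
have q0 : (p + 2)^-1 != 0 by rewrite invr_neq0// gt_eqF//; lra.
have K0 := @smoothing_constant_gt0 R.
have C0 : 0 < 1 + smoothing_constant * (1 + M).
  by have : 0 <= smoothing_constant * (1 + M); [rewrite mulr_ge0 ?ltW//; lra|lra].
have i1 := finite_mean_integrable m1.
have i2 := finite_mean_integrable m2.
have EE : (`|'E_P1[X1] - 'E_P2[X2]| =
    `|\int[P1]_w X1 w - \int[P2]_w X2 w|%:E)%E.
  by rewrite unlock -abse_EFin EFinB /Rintegral !fineK//; exact: integrable_fin_num.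
have DE : Delta X1 X2 psi1 psi1' psi2 psi2' =
    (`|\int[P1]_w X1 w - \int[P2]_w X2 w|%:E +
     \int[lebesgue_measure]_u (levy_weight u *
       `|levy_density psi1 psi1' u - levy_density psi2 psi2' u|)%:E)%E.
  by rewrite integral_levy_weight// /Delta EE !addeA.
have mf1 := measurable_levy_density d1p d1n.
have mf2 := measurable_levy_density d2p d2n.
have mw : measurable_fun setT (fun u => levy_weight u *
    `|levy_density psi1 psi1' u - levy_density psi2 psi2' u|).
  apply: measurable_funM; first exact: measurable_levy_weight.
  by apply: measurableT_comp => //; exact: measurable_funB.
have w0 u : 0 <= levy_weight u *
    `|levy_density psi1 psi1' u - levy_density psi2 psi2' u|.
  by rewrite mulr_ge0 ?levy_weight_ge0.
(* If the weighted difference is not integrable, [Delta] is [+oo]; so is its power, the exponent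
   being positive, and the bound is trivial. *)
have [wf|nwf] := pselect (lebesgue_measure.-integrable setT
  (EFin \o (fun u => levy_weight u *
    `|levy_density psi1 psi1' u - levy_density psi2 psi2' u|))); last first.
  have -> : Delta X1 X2 psi1 psi1' psi2 psi2' = +oo%E.
    rewrite DE; apply: contra_notP nwf => /eqP; rewrite -ltey => Doo.
    apply/integrableP; split; first exact/measurable_EFinP.
    under eq_integral do rewrite /= ger0_norm//.
    apply: le_lt_trans Doo; apply: leeDr; by rewrite lee_fin.
  by rewrite poweRyr// gt0_muley ?lte_fin// leey.
pose D := `|\int[P1]_w X1 w - \int[P2]_w X2 w| +
  levy_distance (levy_density psi1 psi1') (levy_density psi2 psi2').
have -> : Delta X1 X2 psi1 psi1' psi2 psi2' = D%:E.
  by rewrite DE /D EFinD /levy_distance /Rintegral fineK//; exact: integrable_fin_num.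
have D0 : 0 <= D by rewrite addr_ge0// levy_distance_ge0.
rewrite poweR_EFin -EFinM.
apply: dK_le_powR => //; first exact: ltW.
move=> delta dd x; apply: ccdf_smoothing => //.
move=> t y t0; apply: (Rintegral_sin_dist i1 i2 ID1 ID2) => //.
- by move=> u; exact: (levy_density_ge0 _ d1p d1n E1).
- by move=> u; exact: (levy_density_ge0 _ d2p d2n E2).
Qed.

Theorem proposition4p2 (R : realType)
    (mu : probability R R) (C p : R) (hC : 0 < C) (hp : 1 <= p) :
  exists C' : R, 0 < C' /\
  forall
    (* the limit X, with law mu *)
    (d : measure_display) (T : measurableType d) (P : probability T R)
    (X : {RV P >-> R})
    (b : R) (nu : {measure set R -> \bar R}) (psi1 psi2 : R -> R)
    (* the sequence *)
    (ds : nat -> measure_display) (Ts : forall n, measurableType (ds n))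
    (Ps : forall n, probability (Ts n) R) (Xs : forall n, {RV (Ps n) >-> R})
    (bs : nat -> R) (nus : nat -> {measure set R -> \bar R})
    (psi1s psi2s : nat -> R -> R),
  (forall A : set R, measurable A -> distribution P X A = mu A) ->
  nondegenerate_rv X ->
  ID X b nu ->
  finite_mean X ->
  decreasing_on_pos psi1 ->
  decreasing_on_pos psi2 ->
  has_density nu (levy_density psi1 psi2) ->
  (forall n, nondegenerate_rv (Xs n)) ->
  (forall n, ID (Xs n) (bs n) (nus n)) ->
  (forall n, finite_mean (Xs n)) ->
  (forall n, decreasing_on_pos (psi1s n)) ->
  (forall n, decreasing_on_pos (psi2s n)) ->
  (forall n, has_density (nus n) (levy_density (psi1s n) (psi2s n))) ->
  cvg_in_law Xs X ->
  (forall t : R,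
     ((normc (charfun X t))%:E *
        \int[lebesgue_measure]_(s in `[0%R, `|t|%R])
          ((normc (charfun X s))^-1)%:E
      <= (C * `|t| `^ p)%:E)%E) ->
  has_bounded_density (distribution P X) ->
  forall n : nat,
    (dK (Xs n) X <=
     C'%:E * Delta (Xs n) X (psi1s n) (psi2s n) psi1 psi2 `^ (p + 2)^-1)%E.
Proof.
(* The constant is chosen before [X] and may depend only on [mu]. If [mu] has no bounded density, no
   [X] of law [mu] meets the hypotheses, and any positive constant does. *)
have [dm|ndm] := pselect (has_bounded_density mu); last first.
  exists 1; split=> //; move=> d T P X b nu psi1 psi2 ds Ts Ps Xs bs nus psi1s psi2s.
  move=> Xmu _ _ _ _ _ _ _ _ _ _ _ _ _ _ [f [mf f0 fM fE]]; exfalso.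
  by apply: ndm; exists f; split => // A mA; rewrite -fE//; exact: esym (Xmu A mA).
have [M M0 lipM] := has_bounded_density_lip dm.
exists (1 + smoothing_constant * (1 + M)); split.
  by have : 0 <= smoothing_constant * (1 + M);
    [rewrite mulr_ge0 ?(ltW (@smoothing_constant_gt0 R))//; lra|lra].
move=> d T P X b nu psi1 psi2 ds Ts Ps Xs bs nus psi1s psi2s.
move=> Xmu _ IDX mX d1 d2 nuE _ IDs mXs d1s d2s nusE _ _ _ n.
apply: (dK_le_Delta hp M0 (IDs n) IDX (mXs n) mX) => //.
move=> x s s0; rewrite ccdfB// -lee_fin fineK ?fin_num_measure// Xmu//.
exact: lipM.
Qed.
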